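(* Let $\rho=\lambda-(\sup(p_0)-\inf(p_0))$. For any processes $(\eta_t)_{t\ge 0}$ and $(\eta'_t)_{t\ge 0}$ generated by $\mathcal{L}$ (Fleming-Viot processes with $N$ particles), and for any $t\ge 0$, $$\mathcal{W}_{d_1}(\mathrm{Law}(\eta_t),\mathrm{Law}(\eta'_t))\le e^{-\rho t}\,\mathcal{W}_{d_1}(\mathrm{Law}(\eta_0),\mathrm{Law}(\eta'_0)).$$ In particular, if $\rho>0$ then there exists a unique invariant distribution $\nu_N$, and it satisfies, for every $t\ge 0$, $$\mathcal{W}_{d_1}(\mathrm{Law}(\eta_t),\nu_N)\le e^{-\rho t}\,\mathcal{W}_{d_1}(\mathrm{Law}(\eta_0),\nu_N).$$
   Context: $F^*$ is a (finite or infinite) countable discrete set, and $(Q_{i,j})_{i,j\in F^*}$ is the transition rate matrix of an irreducible, positive recurrent (in particular non-explosive) continuous-time Markov process on $F^*$. The function $p_0:F^*\to[0,\infty)$ (death rate) is not identically zero and $\sup(p_0)<\infty$; $\sup(p_0),\inf(p_0)$ are taken over $F^*$. $N\ge 2$ is an integer and $E=\{\eta:F^*\to\mathbb{N} : \sum_{i\in F^*}\eta(i)=N\}$. For $\eta\in E$ with $\eta(i)\ne 0$ and $j\neq i$, $T_{i\to j}\eta$ is the configuration with $T_{i\to j}\eta(i)=\eta(i)-1$, $T_{i\to j}\eta(j)=\eta(j)+1$, and $T_{i\to j}\eta(k)=\eta(k)$ for $k\notin\{i,j\}$ (and $T_{i\to i}\eta=\eta$). The Fleming-Viot process with $N$ particles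 is the continuous-time Markov process on $E$ whose generator, for bounded $f:E\to\mathbb{R}$, is $$\mathcal{L}f(\eta)=\sum_{i\in F^*}\eta(i)\sum_{j\in F^*}\big(f(T_{i\to j}\eta)-f(\eta)\big)\Big(Q_{i,j}+p_0(i)\frac{\eta(j)}{N-1}\Big).$$ The parameter $\lambda$ is $$\lambda=\inf_{i,i'\in F^*,\,i\ne i'}\Big(Q_{i,i'}+Q_{i',i}+\sum_{j\ne i,i'}Q_{i,j}\wedge Q_{i',j}\Big).$$ On $E$ the distance is $d_1(\eta,\eta')=\frac12\sum_{j\in F^*}|\eta(j)-\eta'(j)|$. For probability measures $\mu,\mu'$ on $E$, $\mathcal{W}_{d_1}(\mu,\mu')=\inf\mathbb{E}[d_1(\eta,\eta')]$, the infimum being over all couples of random variables $(\eta,\eta')$ with $\eta\sim\mu$, $\eta'\sim\mu'$. $\mathrm{Law}(X)$ denotes the law of a random variable $X$. *)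

(* Defs.v *)
From HB Require Import structures.
From mathcomp Require Import all_boot all_order all_algebra.
From mathcomp Require Import all_classical all_reals all_analysis.
From mathcomp Require Import finmap measurable_realfun.

Set Implicit Arguments.
Unset Strict Implicit.
Unset Printing Implicit Defensive.
Import Order.TTheory GRing.Theory Num.Theory.
Import numFieldNormedType.Exports.

Local Open Scope classical_set_scope.
Local Open Scope ring_scope.

(* Sum of an absolutely summable real family over a discrete index set. *)
Definition asum (R : realType) (I : choiceType) (f : I -> R) : R :=
  fine (\esum_(i in [set: I]) (EFin \o f)^\+ i
        - \esum_(i in [set: I]) (EFin \o f)^\- i)%E.

Section RateMatrix.
Context (R : realType) (F : pointedType).
Implicit Types (Q : F -> F -> R) (i j : F).

(* Stable and conservative. *)
Definition rate_matrix Q : Prop :=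
  (forall i j, i != j -> 0 <= Q i j) /\
  (forall i, \esum_(j in [set j | j != i]) (Q i j)%:E = (- Q i i)%:E).

(* An edge of the path is never a loop, since diagonal rates are <= 0. *)
Definition irreducible Q : Prop :=
  forall i j, exists p : seq F, path (fun x y => 0 < Q x y) i p /\ last i p = j.

Definition jump_matrix Q i j : R :=
  if i == j then (Q i i == 0)%:R
  else if Q i i == 0 then 0 else Q i j / (- Q i i).

(* [Y] and [S] are the jump chain and the holding times of the (minimal)
   continuous-time Markov process with rate matrix [Q] started at [i]: [Y] is a
   Markov chain with transition matrix [jump_matrix Q] and, given [Y], the
   [S k] are independent exponential variables of parameters [- Q (Y k) (Y k)]
   (infinite when this parameter is 0). *)
Definition jump_chain_holding_times Q i d (Om : measurableType d)
    (P : probability Om R) (Y : nat -> Om -> F) (S : nat -> Om -> \bar R) :=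
  [/\ forall k (A : set F), measurable (Y k @^-1` A),
      forall k, measurable_fun [set: Om] (S k),
      forall k w, (0 <= S k w)%E &
      forall n (y : nat -> F) (s : nat -> R), (forall k, 0 <= s k) ->
        P [set w | forall k, (k <= n)%N -> Y k w = y k /\ ((s k)%:E < S k w)%E] =
        ((y 0%N == i)%:R
         * (\prod_(k < n) jump_matrix Q (y k) (y k.+1))
         * (\prod_(k < n.+1) expR (Q (y k) (y k) * s k)))%:E].

(* First jump time at which the process is at [i]; the n-th jump time is
   [\sum_(k < n) S k], and the value is +oo if there is no such jump time, in
   particular if the process explodes first. *)
Definition return_time (Om : Type) (Y : nat -> Om -> F) (S : nat -> Om -> \bar R)
    i (w : Om) : \bar R :=
  ereal_inf [set (\sum_(k < n) S k w)%E | n in [set n | (0 < n)%N /\ Y n w = i]].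

(* Every state is absorbing or has finite expected return time. *)
Definition positive_recurrent Q : Prop :=
  forall i, Q i i = 0 \/
    exists d (Om : measurableType d) (P : probability Om R)
        (Y : nat -> Om -> F) (S : nat -> Om -> \bar R),
      jump_chain_holding_times Q i P Y S /\
      (\int[P]_w return_time Y S i w < +oo)%E.

(* Takes the value +oo when [F] has a single element. *)
Definition lambda Q : \bar R :=
  ereal_inf [set l | exists i i', i != i' /\
    l = ((Q i i' + Q i' i)%:E +
         \esum_(j in [set j | j != i /\ j != i'])
           (Num.min (Q i j) (Q i' j))%:E)%E].

Definition rho Q (p0 : F -> R) : \bar R :=
  (lambda Q - (sup (range p0) - inf (range p0))%:E)%E.

End RateMatrix.

Definition is_configuration (F : pointedType) (N : nat) (eta : F -> nat) : Prop :=
  finite_set [set i | eta i != 0%N] /\ \sum_(i \in [set: F]) eta i = N.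

Record configuration (F : pointedType) (N : nat) := Configuration {
  occupation :> F -> nat;
  configurationP : `[< is_configuration N occupation >] }.

HB.instance Definition _ F N := [isSub for @occupation F N].
HB.instance Definition _ F N := [Choice of configuration F N by <:].

Lemma point_configuration_subproof (F : pointedType) (N : nat) :
  `[< is_configuration N (fun i : F => if i == point then N else 0%N) >].
Proof.
apply/asboolP; split.
  apply: (@sub_finite_set _ _ [set point]); last exact: finite_set1.
  by move=> i /=; case: (eqVneq i point).
rewrite (fsbigTE [fset point]%fset); last first.
  by move=> i; rewrite !inE => /negPf ->.
by rewrite big_seq_fset1 eqxx.
Qed.

HB.instance Definition _ F N := isPointed.Build (configuration F N)
  (Configuration (point_configuration_subproof F N)).

HB.instance Definition _ F N := @isMeasurable.Build default_measure_display
  (configuration F N) (@discrete_measurable _) (@discrete_measurable0 _)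
  (@discrete_measurableC _) (@discrete_measurableU _).

Section FlemingViot.
Context (R : realType) (F : pointedType) (N : nat).
Local Notation E := (configuration F N).
Implicit Types (Q : F -> F -> R) (eta : E) (i j : F).

Definition move_fun i j (eta : F -> nat) : F -> nat :=
  fun k => (eta k - (k == i) + (k == j))%N.

(* [insubd] only uses its default value [eta] when [eta i = 0], see [moveE]. *)
Definition move i j eta : E := insubd eta (move_fun i j eta).

Lemma is_configuration_move_fun i j eta : eta i != 0%N ->
  is_configuration N (move_fun i j eta).
Proof.
move=> etai; have /asboolP[fin_eta sum_eta] := configurationP eta.
pose B := (fset_set [set k | eta k != 0%N] `|` [fset i; j])%fset.
have supp_eta k : k \notin B -> eta k = 0%N.
  by apply: contraNeq => etak; rewrite !inE in_fset_set// mem_set.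
have supp_move k : k \notin B -> move_fun i j eta k = 0%N.
  move=> kB; rewrite /move_fun supp_eta// sub0n add0n.
  by move: kB; rewrite !inE !negb_or => /and3P[_ _ /negPf ->].
split.
  apply: (@sub_finite_set _ _ [set` B]); last exact: finite_fset.
  by move=> k /=; apply: contraNT => /supp_move ->.
have sum1 l : l \in B -> \sum_(k <- B) nat_of_bool (k == l) = 1%N.
  move=> lB; rewrite (bigD1_seq l)//= eqxx big1 ?addr0//.
  by move=> k /negPf ->.
apply: etrans sum_eta; rewrite !(fsbigTE B)//.
apply: (@addIn 1%N); rewrite -{1}(sum1 i) ?inE ?eqxx ?orbT//.
rewrite -(sum1 j) ?inE ?eqxx ?orbT//.
rewrite -[LHS]big_split -[RHS]big_split; apply: eq_bigr => k _.
rewrite /= /move_fun addnAC; congr addn.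
by case: eqP => [->|_]; rewrite ?subn0 ?addn0// subnK// lt0n.
Qed.

Lemma moveE i j eta : eta i != 0%N ->
  move i j eta = move_fun i j eta :> (F -> nat).
Proof.
move=> etai; rewrite -[LHS]/(val (move i j eta)) insubdK//.
exact/asboolP/is_configuration_move_fun.
Qed.

Definition FV_generator Q (p0 : F -> R) (f : E -> R) (eta : E) : R :=
  \sum_(i \in [set: F]) (eta i)%:R *
    asum (fun j => (f (move i j eta) - f eta) *
                   (Q i j + p0 i * ((eta j)%:R / (N.-1)%:R))).

(* [Pt] is the transition function of a (non-explosive) Markov process on E
   with generator [L], in the sense that d/dt Pt f = L f at t = 0, pointwise,
   for every bounded f. Only times t >= 0 are meaningful. *)
Definition transition_function (L : (E -> R) -> E -> R)
    (Pt : R -> E -> probability E R) : Prop :=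
  [/\ forall eta (A : set E), Pt 0 eta A = \d_eta A,
      forall (s t : R) eta (A : set E), 0 <= s -> 0 <= t ->
        Pt (s + t) eta A = (\int[Pt s eta]_xi Pt t xi A)%E &
      forall (f : E -> R) eta, bounded_fun f ->
        (\int[Pt t eta]_xi f xi - f eta) / t @[t --> 0^'+] --> L f eta].

Definition natural_filtration (Om : Type) (X : R -> Om -> E) (s : R) :
    set_system Om :=
  <<s [set B | exists (u : R) (C : set E), 0 <= u <= s /\ B = X u @^-1` C] >>.

Definition markov_process (Pt : R -> E -> probability E R)
    d (Om : measurableType d) (P : probability Om R) (X : R -> {RV P >-> E}) :=
  forall (s t : R) (B : set Om) (A : set E), 0 <= s -> 0 <= t ->
    natural_filtration X s B ->
    P (B `&` X (s + t) @^-1` A) = (\int[P]_(w in B) Pt t (X s w) A)%E.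

Definition FV_transition_function Q (p0 : F -> R) :=
  transition_function (FV_generator Q p0).

Definition FV_process Q (p0 : F -> R) d (Om : measurableType d)
    (P : probability Om R) (X : R -> {RV P >-> E}) : Prop :=
  exists Pt, FV_transition_function Q p0 Pt /\ markov_process Pt X.

Definition invariant_distribution (Pt : R -> E -> probability E R)
    (nu : probability E R) : Prop :=
  forall (t : R) (A : set E), 0 <= t -> (\int[nu]_eta Pt t eta A)%E = nu A.

(* The sum has finite support. *)
Definition d1 (eta eta' : E) : R :=
  2^-1 * \sum_(j \in [set: F]) `|(eta j)%:R - (eta' j)%:R : R|.

Definition wasserstein (mu mu' : probability E R) : \bar R :=
  ereal_inf [set c | exists d (Om : measurableType d) (P : probability Om R)
      (X X' : {RV P >-> E}),
    [/\ forall A : set E, distribution P X A = mu A,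
        forall A : set E, distribution P X' A = mu' A &
        c = ('E_P [fun w => d1 (X w) (X' w)])%E]].

End FlemingViot.

(* Main.v *)
From HB Require Import structures.
Require Import Defs.
From mathcomp Require Import all_boot all_order all_algebra.
From mathcomp Require Import all_classical all_reals all_analysis.
From mathcomp Require Import finmap measurable_realfun.
From mathcomp Require Import ring lra zify.
Import Order.TTheory GRing.Theory Num.Theory.
Import numFieldNormedType.Exports.

(** The two semigroups are compared by a maximum principle, and Wasserstein
    distances are reached by duality, so that no coupled process has to be
    constructed.

    Coupling the generators. The particles of two configurations are paired so
    that d1 counts the pairs whose members sit at different sites
    ([optimal_labels]). Paired particles jump together as much as their rates
    allow, and a particle that dies is replaced by a copy of a particle whose
    index is the same in both configurations. A split pair then meets at a rate
    of at least lambda ([pair_drift]). Death adds a split pair when a particle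
    of an unsplit pair copies one of a split pair, and it removes one in the
    opposite case; the two effects cancel up to the variations of p0, which
    costs sup p0 - inf p0 ([selection_drift]). Altogether the coupled generator
    maps d1 below - rho d1. What is used is the form that this takes for two
    functions: if u(xi) - u'(xi') is below a multiple of d1 for all xi, xi', with
    equality at (eta, eta'), then L u(eta) - L u'(eta') is below - rho times that
    value ([coupling_inequality]).

    Maximum principle. Let f(xi) - g(xi') <= d1(xi, xi'). The functions P_t f and
    P'_t g solve the backward equation, so at a first contact of their difference
    with exp(- rho t) d1 the coupling inequality would be violated; hence
    P_t f(xi) - P'_t g(xi') <= exp(- rho t) d1(xi, xi') for all t
    ([semigroup_contraction]). The state space is infinite and the rates are
    unbounded, so a contact is only sure to occur after exp(- rho t) d1 has been
    raised by a small multiple of a function that has finite sublevel sets and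
    grows at most exponentially under the dynamics. Such a function is built by
    summing over particles a function V on the sites with Q V <= V and finite
    sublevel sets. The latter exists because a positive recurrent chain does not
    explode ([lyapunov_exists]): V is a series of functions v_m that equal 1
    outside finite sets increasing to the whole space, satisfy Q v_m <= v_m and
    tend to 0. They do tend to 0 because their limit u is bounded with u <= Q u,
    and the return of the chain to its starting point forces u = 0
    ([subsolution0]).

    Duality. If mu(f) - nu(g) <= B whenever f(x) - g(y) <= d1(x, y), then mu and
    nu have a coupling of cost at most B ([kantorovich]): the Hahn-Banach theorem
    gives a positive functional on the bounded functions of a pair of
    configurations, and its marginals make it tight, hence a probability. For the
    laws at time t, the pair (f, g) is carried to (P_t f, P'_t g), whose
    difference is at most exp(- rho t) d1; integration against an arbitrary
    coupling of the initial laws gives the contraction.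

    Invariant law. As d1 <= N, for rho > 0 the contraction makes P_t f converge
    to a constant, uniformly over the starting points and over |f| <= 1. As a
    functional of f this limit is tight, hence a probability; the uniformity
    makes it invariant and makes it the only invariant probability
    ([invariant_exists]). *)

Set Implicit Arguments.
Unset Strict Implicit.
Unset Printing Implicit Defensive.

Local Open Scope classical_set_scope.
Local Open Scope ring_scope.


(** * Linear functionals below a sublinear one *)

Section HahnBanach.
Context (R : realType) (V : lmodType R) (D : set V).
Hypothesis DD : forall u v, D u -> D v -> D (u + v).
Hypothesis DZ : forall (a : R) u, D u -> D (a *: u).
Implicit Types (p q : V -> R) (u v x : V).

(** Everything is relative to a linear subspace [D] of [V]: the functionals of
    interest are finite on bounded functions only. With t and 1/t, the second
    inequality gives equality for t > 0. *)
Definition sublinear p :=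
  (forall u v, D u -> D v -> p (u + v) <= p u + p v) /\
  (forall (t : R) u, 0 <= t -> D u -> p (t *: u) <= t * p u).

Let DN u : D u -> D (- u).
Proof. by move=> Du; rewrite -scaleN1r; exact: DZ. Qed.

Lemma sublinear0 p x : D x -> sublinear p -> p 0 = 0.
Proof.
move=> Dx [pD pZ]; have D0 : D 0 by rewrite -(scale0r x); exact: DZ.
apply/le_anti; apply/andP; split.
  by have := pZ 0 x (lexx _) Dx; rewrite scale0r mul0r.
by have := pD 0 0 D0 D0; rewrite addr0; lra.
Qed.

Lemma sublinear_ge p x : D x -> sublinear p -> - p (- x) <= p x.
Proof.
move=> Dx sp; have [pD _] := sp.
have := pD x (- x) Dx (DN Dx); rewrite subrr (sublinear0 Dx sp); lra.
Qed.

(** An upper bound for the linear functionals l below [p] with [l x = p x]: these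
    satisfy [l y = l (y + t *: x) - t * p x]. *)
Definition slope p x y : R :=
  inf [set p (y + t *: x) - t * p x | t in [set t : R | 0 <= t]].

Lemma slope_lb p x y : D x -> D y -> sublinear p ->
  lbound [set p (y + t *: x) - t * p x | t in [set t : R | 0 <= t]] (- p (- y)).
Proof.
move=> Dx Dy [pD pZ] _ [t /= t0 <-].
have [->|tn0] := eqVneq t 0.
  by rewrite scale0r addr0 mul0r subr0; exact: sublinear_ge.
have tp : 0 < t by rewrite lt_neqAle eq_sym tn0.
have h1 := pD (y + t *: x) (- y) (DD Dy (DZ t Dx)) (DN Dy).
rewrite addrAC subrr add0r in h1.
have h2 : t * p x <= p (t *: x).
  rewrite -ler_pdivlMl//.
  have := pZ t^-1 (t *: x); rewrite invr_ge0 scalerA mulVf// scale1r; apply => //.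
  exact: DZ.
lra.
Qed.

Lemma slope_le p x y t : D x -> D y -> sublinear p -> 0 <= t ->
  slope p x y <= p (y + t *: x) - t * p x.
Proof.
move=> Dx Dy sp t0; apply: ge_inf; last by exists t.
by exists (- p (- y)); exact: slope_lb.
Qed.

Lemma le_slope p x y c : (forall t, 0 <= t -> c <= p (y + t *: x) - t * p x) ->
  c <= slope p x y.
Proof.
move=> h; apply: lb_le_inf; first by exists (p (y + 0 *: x) - 0 * p x), 0 => /=.
by move=> _ [t /= t0 <-]; exact: h.
Qed.

Lemma sublinear_slope p x : D x -> sublinear p -> sublinear (slope p x).
Proof.
move=> Dx sp; have [pD pZ] := sp; split=> [u v Du Dv|a u a0 Du].
  rewrite -lerBlDr; apply: le_slope => t t0; rewrite lerBlDl -lerBlDr.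
  apply: le_slope => s s0; rewrite lerBlDl.
  apply: (le_trans (slope_le Dx (DD Du Dv) sp (addr_ge0 t0 s0))).
  have := pD (u + t *: x) (v + s *: x) (DD Du (DZ t Dx)) (DD Dv (DZ s Dx)).
  rewrite addrACA -scalerDl; lra.
have [->|an0] := eqVneq a 0.
  rewrite scale0r mul0r; have D0 : D 0 by rewrite -(scale0r x); exact: DZ.
  apply: (le_trans (slope_le Dx D0 sp (lexx 0))).
  by rewrite scale0r addr0 (sublinear0 Dx sp); lra.
have ap : 0 < a by rewrite lt_neqAle eq_sym an0.
rewrite -ler_pdivrMl//; apply: le_slope => t t0; rewrite ler_pdivrMl//.
apply: (le_trans (slope_le Dx (DZ a Du) sp (mulr_ge0 a0 t0))).
have := pZ a (u + t *: x) a0 (DD Du (DZ t Dx)).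
rewrite scalerDr scalerA; lra.
Qed.

Lemma slope_leid p x y : D x -> D y -> sublinear p -> slope p x y <= p y.
Proof.
move=> Dx Dy sp; apply: (le_trans (slope_le Dx Dy sp (lexx 0))).
by rewrite scale0r addr0 mul0r subr0.
Qed.

(** Zorn's lemma: along a chain of sublinear functionals below [p], the pointwise
    infimum is finite, as each value at [x] is at least [- p (- x)], and it is
    again sublinear. *)
Lemma minimal_sublinear p : sublinear p ->
  exists2 q, sublinear q /\ (forall x, D x -> q x <= p x) &
    forall q', sublinear q' -> (forall x, D x -> q' x <= q x) ->
      forall x, D x -> q x <= q' x.
Proof.
move=> sp.
pose X := {q : V -> R | sublinear q /\ forall x, D x -> q x <= p x}.
pose r (q1 q2 : X) := `[< forall x, D x -> sval q2 x <= sval q1 x >].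
have p0 : sublinear p /\ forall x, D x -> p x <= p x by split.
have [||A totA|[q [sq qp]] qmax] := @ZL_preorder X (exist _ p p0) r.
- by move=> q; apply/asboolP.
- move=> q1 q2 q3 /asboolP q12 /asboolP q23; apply/asboolP => x Dx.
  exact: le_trans (q23 x Dx) (q12 x Dx).
- have [[q0 Aq0]|A0] := pselect (exists q : X, A q); last first.
    by exists (exist _ p p0) => q Aq; exfalso; apply: A0; exists q.
  pose m x := inf [set sval (q : X) x | q in A].
  have mlb x : D x -> has_lbound [set sval (q : X) x | q in A].
    move=> Dx; exists (- p (- x)) => _ [[q [sq qp]] /= Aq <-].
    apply: le_trans (sublinear_ge Dx sq); rewrite lerN2; exact/qp/DN.
  have mle x (q : X) : D x -> A q -> m x <= sval q x.
    by move=> Dx Aq; apply: ge_inf; [exact: mlb|exists q].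
  have lem x c : (forall q : X, A q -> c <= sval q x) -> c <= m x.
    move=> h; apply: lb_le_inf; first by exists (sval q0 x), q0.
    by move=> _ [q Aq <-]; exact: h.
  have sm : sublinear m.
    split=> [u v Du Dv|t u t0 Du].
      rewrite -lerBlDr; apply: (lem) => q1 Aq1; rewrite lerBlDl -lerBlDr.
      apply: (lem) => q2 Aq2; rewrite lerBlDl.
      have [q [Aq qle1 qle2]] : exists q : X, [/\ A q, forall x, D x -> sval q x <= sval q1 x
          & forall x, D x -> sval q x <= sval q2 x].
        have [/asboolP h|/asboolP h] := totA _ _ Aq1 Aq2; first by exists q2.
        by exists q1.
      apply: (le_trans (mle _ _ (DD Du Dv) Aq)).
      have [[qD _] _] := svalP q.
      by apply: (le_trans (qD _ _ Du Dv)); rewrite lerD// ?qle1 ?qle2.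
    have [->|tn0] := eqVneq t 0.
      rewrite mul0r scale0r; have D0 : D 0 by rewrite -(scale0r u); exact: DZ.
      apply: (le_trans (mle _ _ D0 Aq0)).
      by have [sq0 _] := svalP q0; rewrite (sublinear0 Du sq0).
    have tp : 0 < t by rewrite lt_neqAle eq_sym tn0.
    rewrite -ler_pdivrMl//; apply: (lem) => q Aq; rewrite ler_pdivrMl//.
    apply: (le_trans (mle _ _ (DZ t Du) Aq)).
    by have [[_ qZ] _] := svalP q; exact: qZ.
  have mp : sublinear m /\ forall x, D x -> m x <= p x.
    split=> // x Dx; apply: (le_trans (mle _ _ Dx Aq0)).
    by have [_] := svalP q0; exact.
  exists (exist _ m mp) => q Aq; apply/asboolP => x Dx /=; exact: mle.
- exists q => // q' sq' q'q.
  have q'p : sublinear q' /\ forall x, D x -> q' x <= p x.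
    by split=> // x Dx; apply: le_trans (q'q x Dx) (qp x Dx).
  have /asboolP := qmax (exist _ q' q'p) (asboolT q'q); exact.
Qed.

(** By minimality [q <= slope q v], and the term t = 1 of the infimum gives
    [q u <= q (u + v) - q v], the missing half of additivity. *)
Lemma linear_of_minimal q :
  sublinear q ->
  (forall q', sublinear q' -> (forall x, D x -> q' x <= q x) ->
    forall x, D x -> q x <= q' x) ->
  (forall u v, D u -> D v -> q (u + v) = q u + q v) /\
  (forall (a : R) u, D u -> q (a *: u) = a * q u).
Proof.
move=> sq qmin.
have qD u v : D u -> D v -> q (u + v) = q u + q v.
  move=> Du Dv; apply/le_anti; rewrite (sq.1 _ _ Du Dv)/=.
  have := qmin _ (sublinear_slope Dv sq) (fun y Dy => slope_leid Dv Dy sq) u Du.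
  move=> /le_trans/(_ (slope_le Dv Du sq ler01)); rewrite scale1r mul1r; lra.
have qN u : D u -> q (- u) = - q u.
  move=> Du; have := qD _ _ Du (DN Du); rewrite subrr (sublinear0 Du sq); lra.
have qZ (a : R) u : 0 <= a -> D u -> q (a *: u) = a * q u.
  move=> a0 Du; apply/le_anti; rewrite (sq.2 _ _ a0 Du)/=.
  have := sq.2 _ _ a0 (DN Du); rewrite scalerN !qN//; [lra|exact: DZ].
split=> // a u Du; have [a0|a0] := leP 0 a; first exact: qZ.
rewrite -[a]opprK scaleNr qN ?qZ//; [lra|lra|exact: DZ].
Qed.

(** Starting from [slope p x] instead of [p] forces [l (- x) <= - p x], hence
    [l x = p x]. *)
Lemma hahn_banach p x : D x -> sublinear p ->
  exists l : V -> R,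
    [/\ forall u v, D u -> D v -> l (u + v) = l u + l v,
        forall (a : R) u, D u -> l (a *: u) = a * l u,
        forall u, D u -> l u <= p u & l x = p x].
Proof.
move=> Dx sp.
have [q [sq qle] qmin] := minimal_sublinear (sublinear_slope Dx sp).
have [qD qZ] := linear_of_minimal sq qmin.
have qp u : D u -> q u <= p u.
  by move=> Du; apply: le_trans (qle _ Du) (slope_leid Dx Du sp).
exists q; split => //; apply/le_anti; rewrite qp//=.
have := qle _ (DN Dx); rewrite -scaleN1r qZ//.
move=> /le_trans/(_ (slope_le Dx (DZ (-1) Dx) sp ler01)).
by rewrite scale1r scaleN1r addNr (sublinear0 Dx sp); lra.
Qed.

End HahnBanach.

(** * Means of bounded functions and the dual transport problem *)

Lemma near_all_mem (T : Type) (I : eqType) (G : set_system T) (s : seq I)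
    (P : I -> T -> Prop) : Filter G ->
  (forall i, \forall x \near G, P i x) ->
  \forall x \near G, forall i, i \in s -> P i x.
Proof.
move=> FG hP; elim: s => [|i s IH]; first by apply: nearW => x i; rewrite in_nil.
apply: filterS (filterI IH (hP i)) => x [h1 h2] j.
by rewrite in_cons => /orP[/eqP ->|/h1].
Qed.

Section Bounded.
Context (R : realType) (T : Type).
Implicit Types (f g : T -> R).

Definition bnd f := exists M : R, forall x, `|f x| <= M.

Lemma bnd_cst c : bnd (fun=> c).
Proof. by exists `|c|. Qed.

Lemma bndD f g : bnd f -> bnd g -> bnd (fun x => f x + g x).
Proof.
move=> [M fM] [M' gM]; exists (M + M') => x.
by apply: le_trans (ler_normD _ _) _; exact: lerD.
Qed.

Lemma bndZ a f : bnd f -> bnd (fun x => a * f x).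
Proof.
by move=> [M fM]; exists (`|a| * M) => x; rewrite normrM ler_wpM2l.
Qed.

Lemma bndN f : bnd f -> bnd (fun x => - f x).
Proof. by move=> [M fM]; exists M => x; rewrite normrN. Qed.

Lemma bndB f g : bnd f -> bnd g -> bnd (fun x => f x - g x).
Proof. by move=> bf bg; apply: bndD => //; exact: bndN. Qed.

Lemma bnd_sum (I : Type) (r : seq I) (F : I -> T -> R) :
  (forall i, bnd (F i)) -> bnd (fun x => \sum_(i <- r) F i x).
Proof.
move=> bF; elim: r => [|i r IH].
  by exists 0 => x; rewrite big_nil normr0.
have := bndD (bF i) IH; congr bnd; apply/funext => x.
by rewrite big_cons.
Qed.

Lemma bnd_indic (A : set T) : bnd (\1_A : T -> R).
Proof. by exists 1 => x; rewrite indicE ger0_norm ?ler0n// lern1 leq_b1. Qed.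

Lemma bnd_bounded f : bnd f -> bounded_fun f.
Proof.
move=> [M fM]; exists M; split; first exact: num_real.
by move=> x Mx y _; apply: le_trans (fM y) (ltW Mx).
Qed.

Lemma bnd_ge0 f : bnd f -> exists2 M : R, 0 < M & forall x, `|f x| <= M.
Proof.
move=> [M fM]; exists (`|M| + 1) => [|x]; first by rewrite ltr_wpDl.
by rewrite (le_trans (fM x))// ler_wpDr// ler_norm.
Qed.

End Bounded.

Section MeanFunctional.
Context (R : realType) (T : Type).
Implicit Types (f g : T -> R) (m : (T -> R) -> R).

(** The finitely additive version of integration against a probability. Limits of
    means along a semigroup and Hahn-Banach functionals are of this kind before
    they are known to be countably additive. *)
Record mean_functional m : Prop := {
  mfD : forall f g, bnd f -> bnd g -> m (fun x => f x + g x) = m f + m g ;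
  mfZ : forall a f, bnd f -> m (fun x => a * f x) = a * m f ;
  mf_le : forall f g, bnd f -> bnd g -> (forall x, f x <= g x) -> m f <= m g ;
  mf1 : m (fun=> 1) = 1 }.

Lemma mf_cst m c : mean_functional m -> m (fun=> c) = c.
Proof.
move=> hm; rewrite -[RHS]mulr1 -(mf1 hm) -mfZ//; last exact: bnd_cst.
by congr m; apply/funext => x; rewrite mulr1.
Qed.

Lemma mfN m f : mean_functional m -> bnd f -> m (fun x => - f x) = - m f.
Proof.
move=> hm bf; rewrite -[RHS]mulN1r -mfZ//; congr m.
by apply/funext => x; rewrite mulN1r.
Qed.

Lemma mfB m f g : mean_functional m -> bnd f -> bnd g ->
  m (fun x => f x - g x) = m f - m g.
Proof.
move=> hm bf bg; rewrite mfD//; last exact: bndN.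
by rewrite mfN.
Qed.

Lemma mf_sum m (I : Type) (r : seq I) (F : I -> T -> R) :
  mean_functional m -> (forall i, bnd (F i)) ->
  m (fun x => \sum_(i <- r) F i x) = \sum_(i <- r) m (F i).
Proof.
move=> hm bF; elim: r => [|i r IH].
  rewrite big_nil -[RHS](mf_cst 0 hm); congr m.
  by apply/funext => x; rewrite big_nil.
rewrite big_cons -IH -mfD//; last exact: bnd_sum.
by congr m; apply/funext => x; rewrite big_cons.
Qed.

Lemma mf_ge0 m f : mean_functional m -> bnd f -> (forall x, 0 <= f x) -> 0 <= m f.
Proof.
move=> hm bf f0; rewrite -(mf_cst 0 hm); apply: mf_le => //; exact: bnd_cst.
Qed.

Lemma mf_norm m f M : mean_functional m -> (forall x, `|f x| <= M) -> `|m f| <= M.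
Proof.
move=> hm fM; have bf : bnd f by exists M.
rewrite ler_norml -{1}(mf_cst (- M) hm) -{2}(mf_cst M hm).
apply/andP; split; apply: mf_le => //; try exact: bnd_cst.
all: by move=> x; have := fM x; rewrite ler_norml => /andP[].
Qed.

(** The sum counts the integers in [1, y], up to k. *)
Lemma staircase (k : nat) (y : R) : 0 <= y ->
  \sum_(j < k) (j.+1%:R <= y)%R%:R <= y /\
  (y <= k%:R -> y <= \sum_(j < k) (j.+1%:R <= y)%R%:R + 1).
Proof.
move=> y0; elim: k => [|k [IH1 IH2]].
  by rewrite big_ord0; split => //; lra.
rewrite big_ord_recr/=; have [ky|ky] := leP k.+1%:R y.
  have -> : \sum_(i < k) ((i.+1%:R <= y)%R%:R : R) = k%:R.
    rewrite (eq_bigr (fun=> 1)); last first.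
      move=> i _; rewrite (le_trans _ ky)// ler_nat.
      by rewrite ltnS ltnW.
    by rewrite sumr_const card_ord.
  by rewrite natr1; split => // yk; lra.
rewrite addr0; split => // yk; have [/IH2//|ky'] := leP y k%:R.
have -> : \sum_(i < k) ((i.+1%:R <= y)%R%:R : R) = k%:R.
  rewrite (eq_bigr (fun=> 1)); last first.
    by move=> i _; rewrite (le_trans _ (ltW ky'))// ler_nat.
  by rewrite sumr_const card_ord.
by rewrite natr1 ltW.
Qed.

(** A bounded function is within a small constant of a staircase function, that
    is, of a combination of indicators of its upper level sets. *)
Lemma mf_le_indic m m' f : mean_functional m -> mean_functional m' ->
  (forall A : set T, m \1_A = m' \1_A) -> bnd f -> m f <= m' f.
Proof.
move=> hm hm' mm' bf; have [M M0 fM] := bnd_ge0 bf.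
apply/ler_addgt0Pr => e e0.
(* Number of steps: the staircase has steps of height 2 M / k <= e. *)
pose k := (Num.truncn (2 * M / e)).+1.
have k0 : 0 < k%:R :> R by rewrite ltr0n.
have ke : 2 * M / k%:R <= e.
  rewrite ler_pdivrMr// [leRHS]mulrC -ler_pdivrMr//.
  by apply/ltW; rewrite /k; apply: truncnS_gt.
pose y x := (f x + M) / (2 * M) * k%:R.
have fE x : f x = y x * (2 * M / k%:R) - M by rewrite /y; field; lra.
pose s x := \sum_(j < k) (\1_[set x | j.+1%:R <= y x] x : R).
have bs : bnd s by apply: bnd_sum => i; exact: bnd_indic.
have sE : m s = m' s.
  by rewrite /s !mf_sum//; [exact: eq_bigr|move=> i; exact: bnd_indic..].
have sy x : s x <= y x /\ y x <= s x + 1.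
  have y0 : 0 <= y x.
    rewrite /y mulr_ge0// divr_ge0//; last by lra.
    by have := fM x; rewrite ler_norml => /andP[]; lra.
  have yk : y x <= k%:R.
    rewrite /y -[leRHS]mul1r ler_pM2r// ler_pdivrMr; last by lra.
    by have := fM x; rewrite ler_norml => /andP[]; lra.
  have [h1 h2] := staircase k y0.
  have -> : s x = \sum_(j < k) (j.+1%:R <= y x)%R%:R.
    by apply: eq_bigr => i _; rewrite indicE; congr (_%:R); congr nat_of_bool;
      rewrite mem_setE.
  by split => //; exact: h2.
have d0 : 0 <= 2 * M / k%:R by rewrite divr_ge0//; lra.
pose g x := (2 * M / k%:R) * s x + (- M).
have bg : bnd g by apply: bndD; [exact: bndZ|exact: bnd_cst].
have gE : m g = m' g.
  by rewrite /g !mfD ?mfZ ?sE ?mf_cst//; try exact: bndZ; exact: bnd_cst.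
have -> : m' f + e = m' (fun x => f x + e) by rewrite mfD ?mf_cst//; exact: bnd_cst.
have h1 : m f <= m (fun x => g x + e).
  apply: mf_le => //; first by apply: bndD => //; exact: bnd_cst.
  move=> x; rewrite fE /g; have [_ h] := sy x.
  have := ler_wpM2r d0 h; lra.
apply: (le_trans h1); rewrite mfD ?mf_cst//; last exact: bnd_cst.
rewrite mfD ?mf_cst//; last exact: bnd_cst.
rewrite -[X in X + _]/(m g) gE lerD2r; apply: mf_le => // x; rewrite fE /g; have [h _] := sy x.
by have := ler_wpM2r d0 h; lra.
Qed.

Lemma mf_ext m m' f : mean_functional m -> mean_functional m' ->
  (forall A : set T, m \1_A = m' \1_A) -> bnd f -> m f = m' f.
Proof.
by move=> hm hm' mm' bf; apply/le_anti; rewrite !mf_le_indic.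
Qed.

End MeanFunctional.

Section MeanProbability.
Context (R : realType) d (T : measurableType d).
Hypothesis mT : forall A : set T, measurable A.
Implicit Types (f g : T -> R).

Lemma bnd_integrable (mu : probability T R) f : bnd f ->
  mu.-integrable [set: T] (EFin \o f).
Proof.
move=> bf; apply: measurable_bounded_integrable => //.
- by rewrite (le_lt_trans (probability_le1 _ _)) ?ltry.
- exact: bnd_bounded.
Qed.

Lemma mf_mean (mu : probability T R) :
  mean_functional (fun f => \int[mu]_x f x)%R.
Proof.
split.
- by move=> f g bf bg; rewrite RintegralD//; exact: bnd_integrable.
- by move=> a f bf; rewrite RintegralZl//; exact: bnd_integrable.
- by move=> f g bf bg fg; apply: le_Rintegral => //; exact: bnd_integrable.
- by rewrite Rintegral_cst// mul1r; exact: (congr1 fine (probability_setT mu)).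
Qed.

Lemma mean_indic (mu : probability T R) (A : set T) :
  (\int[mu]_x \1_A x)%R = fine (mu A).
Proof. by rewrite /Rintegral integral_indic// setIT. Qed.

Definition mf_measure (m : (T -> R) -> R) (hm : mean_functional m)
  (tight : forall e, 0 < e -> exists K : set T, finite_set K /\ m (\1_(~` K)) <= e) :=
  fun A : set T => (m \1_A)%:E.

Section mf_measure.
Context (m : (T -> R) -> R) (hm : mean_functional m)
  (tight : forall e, 0 < e -> exists K : set T, finite_set K /\ m (\1_(~` K)) <= e).
Local Notation mu := (mf_measure hm tight).

Let mu0 : mu set0 = 0%E.
Proof.
by rewrite /mf_measure -[0%E]/(0%:E) -(mf_cst 0 hm); congr (m _)%:E;
  apply/funext => x; rewrite indic0.
Qed.

Let mu_ge0 A : (0 <= mu A)%E.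
Proof.
by rewrite lee_fin; apply: mf_ge0 => //; exact: bnd_indic.
Qed.

Let mu_sigma : semi_sigma_additive mu.
Proof.
move=> A _ tA _.
pose U := \bigcup_i A i.
pose S n := \big[setU/set0]_(i < n) A i.
have SE n : (\sum_(0 <= i < n) mu (A i))%E = (m \1_(S n))%:E.
  rewrite /mf_measure sumEFin; congr (_%:E).
  rewrite big_mkord -mf_sum//; last by move=> i; exact: bnd_indic.
  congr m; apply/funext => x; elim: n => [|n IH].
    by rewrite /S !big_ord0 indic0.
  rewrite /S !big_ord_recr/= IH !indicE -natrD; congr (_%:R).
  rewrite -/(S n) in_setU; case xn : (x \in A n); last by rewrite orbF addn0.
  rewrite orbT; case xS : (x \in S n) => //.
  move/set_mem: xS; rewrite /S -bigcup_mkord => -[i /= ilt Ai].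
  move/set_mem: xn => An.
  have e : i = n by apply: (tA i n I I); exists x.
  by rewrite e ltnn in ilt.
under eq_fun do rewrite SE.
apply: cvg_EFin; first exact: nearW.
apply/cvgrPdist_le => e e0; have [K [fK mK]] := tight e0.
have hK : \forall n \near \oo, forall x, K x -> U x -> S n x.
  move: fK => /finite_seqP[s ->].
  apply: (@near_all_mem _ _ _ s (fun y n => U y -> S n y)) => y.
  have [[i _ Ai]|nU] := pselect (U y); last by apply: nearW => n /nU.
  exists i.+1 => //= n /= ilt _; rewrite /S -bigcup_mkord.
  by exists i.
near=> n; rewrite /= -/(U).
have Sn : forall x, K x -> U x -> S n x by near: n; exact: hK.
have SU : S n `<=` U by rewrite /S -bigcup_mkord => x [i _ Ai]; exists i.
rewrite -mfB//; try exact: bnd_indic.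
have h0 x : 0 <= (\1_U x - \1_(S n) x : R).
  rewrite subr_ge0 !indicE ler_nat; case xS : (x \in S n) => //.
  by rewrite (mem_set (SU _ (set_mem xS))).
rewrite ger0_norm; last by apply: mf_ge0 => //; apply: bndB; exact: bnd_indic.
apply: le_trans mK; apply: mf_le => //; [apply: bndB; exact: bnd_indic|exact: bnd_indic|].
move=> x; rewrite !indicE; case xK : (x \in ~` K).
  by case: (x \in U) (x \in S n) => -[] /=; lra.
have {}xK : K x by apply: contrapT => nK; move: xK; rewrite (@mem_set _ (~` K) x nK).
case xU : (x \in U) => /=; last by case: (x \in S n) => /=; lra.
have xS : S n x := Sn x xK (set_mem xU).
by rewrite mem_set// subrr.
Unshelve. all: by end_near. Qed.

HB.instance Definition _ := isMeasure.Build _ _ _ mu mu0 mu_ge0 mu_sigma.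

Let mu1 : mu setT = 1%E.
Proof.
rewrite /mf_measure; have -> : (\1_setT : T -> R) = fun=> 1.
  by apply/funext => x; rewrite indicT.
by rewrite mf1.
Qed.

HB.instance Definition _ := Measure_isProbability.Build _ _ _ mu mu1.

(** A tight mean functional is countably additive: of countably many disjoint
    sets, all but finitely many miss a given finite set. *)
Lemma mf_probability : exists mu : probability T R,
  forall f, bnd f -> m f = (\int[mu]_x f x)%R.
Proof.
exists mu => f bf; apply: mf_ext => //; first exact: mf_mean.
by move=> A; rewrite mean_indic.
Qed.

End mf_measure.


Lemma countable_tight (cT : countable [set: T]) (mu : probability T R) e : 0 < e ->
  exists K : set T, finite_set K /\ (\int[mu]_x \1_(~` K) x)%R <= e.
Proof.
move=> e0; have /countable_injP[i ii] := cT.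
have injf : injective i by move=> x y; apply: ii; exact: in_setT.
pose B n := [set x | (n <= i x)%N].
have fB n : finite_set (~` B n).
  rewrite (_ : ~` B n = i @^-1` `I_n); last first.
    by apply/seteqP; split=> x /=; rewrite /B/= ltnNge => /negP.
  by apply: finite_preimage => // x y _ _; exact: injf.
have : mu \o B @ \oo --> mu (\bigcap_n B n).
  apply: nonincreasing_cvg_mu => //.
    by rewrite (le_lt_trans (probability_le1 _ _)) ?ltry.
  by move=> m n mn; apply/subsetPset => x; rewrite /B/=; exact: leq_trans.
have -> : \bigcap_n B n = set0.
  by rewrite -subset0 => x /(_ (i x).+1 I); rewrite /B/= ltnn.
rewrite measure0 => /fine_cvgP[_ /cvgrPdist_le/(_ e e0)].
case=> n _ /(_ n (leqnn n)); rewrite /= sub0r normrN => h.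
exists (~` B n); split => //; rewrite setCK mean_indic.
exact: le_trans (ler_norm _) h.
Qed.

End MeanProbability.

(** The pairs with the discrete sigma-algebra, in place of the product one, so
    that no measurability has to be checked when a coupling is built. *)
Definition discrete_pair (T : pointedType) : Type := (T * T)%type.
HB.instance Definition _ (T : pointedType) := Pointed.copy (discrete_pair T) (T * T)%type.
HB.instance Definition _ (T : pointedType) :=
  @isMeasurable.Build default_measure_display (discrete_pair T)
   (@discrete_measurable _) (@discrete_measurable0 _)
   (@discrete_measurableC _) (@discrete_measurableU _).

Section Kantorovich.
Context (R : realType) d (T : measurableType d).
Hypothesis mT : forall A : set T, measurable A.
Hypothesis cT : countable [set: T].
Context (mu nu : probability T R).
Implicit Types (f g : T -> R) (phi : T * T -> R).

Local Notation mean m f := (\int[m]_x f x)%R.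

Definition dual_pair phi : set ((T -> R) * (T -> R)) :=
  [set fg | [/\ bnd fg.1, bnd fg.2 & forall x y, phi (x, y) <= fg.1 x + fg.2 y]].

(** The cost of covering [phi] from above by a sum of functions of one variable.
    It is sublinear, and the linear functionals below it are the finitely
    additive couplings of [mu] and [nu]. *)
Definition dual_cost phi : R :=
  inf [set mean mu fg.1 + mean nu fg.2 | fg in dual_pair phi].

Let hmu := mf_mean mT mu.
Let hnu := mf_mean mT nu.

(** Integrate the inequality over [x] for [y] fixed, then over [y]. *)
Lemma dual_pair_ge f g c : bnd f -> bnd g -> (forall x y, c <= f x + g y) ->
  c <= mean mu f + mean nu g.
Proof.
move=> bf bg cfg.
have h1 y : c - g y <= mean mu f.
  rewrite -(mf_cst (c - g y) hmu); apply: mf_le => //; first exact: bnd_cst.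
  by move=> x; have := cfg x y; lra.
have : c - mean mu f <= mean nu g.
  rewrite -(mf_cst (c - mean mu f) hnu); apply: mf_le => //; first exact: bnd_cst.
  by move=> y; have := h1 y; lra.
lra.
Qed.

Lemma dual_cost_le phi f g : bnd phi -> bnd f -> bnd g ->
  (forall x y, phi (x, y) <= f x + g y) -> dual_cost phi <= mean mu f + mean nu g.
Proof.
move=> [M bphi] bf bg h; apply: ge_inf; last by exists (f, g).
exists (- M) => _ [[f' g'] [/= bf' bg' h'] <-]; apply: dual_pair_ge => // x y.
by apply: le_trans (h' x y); have := bphi (x, y); rewrite ler_norml => /andP[].
Qed.

Lemma le_dual_cost phi c : bnd phi ->
  (forall f g, bnd f -> bnd g -> (forall x y, phi (x, y) <= f x + g y) ->
    c <= mean mu f + mean nu g) -> c <= dual_cost phi.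
Proof.
move=> [M bphi] h; apply: lb_le_inf.
  exists (mean mu (fun=> M) + mean nu (fun=> 0)), (fun=> M, fun=> 0) => //=.
  split; [exact: bnd_cst|exact: bnd_cst|move=> x y /=; rewrite addr0].
  exact: le_trans (ler_norm _) (bphi _).
by move=> _ [[f g] [/= bf bg hfg] <-]; exact: h.
Qed.

Lemma sublinear_dual_cost : sublinear (@bnd R (T * T)) dual_cost.
Proof.
split=> [u v bu bv|t u t0 bu].
  rewrite -lerBlDr; apply: le_dual_cost => // f g bf bg h.
  rewrite lerBlDl -lerBlDr; apply: le_dual_cost => // f' g' bf' bg' h'.
  rewrite lerBlDl.
  apply: (le_trans (@dual_cost_le _ (fun x => f x + f' x) (fun x => g x + g' x) _ _ _ _)).
  - exact: bndD.
  - exact: bndD.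
  - exact: bndD.
  - by move=> x y; have := h x y; have := h' x y; rewrite /= !fctE; lra.
  - by rewrite (mfD hmu)// (mfD hnu)//; lra.
have [->|tn0] := eqVneq t 0.
  rewrite mul0r; apply: (le_trans (@dual_cost_le _ (fun=> 0) (fun=> 0) _ _ _ _)).
  - exact: bndZ.
  - exact: bnd_cst.
  - exact: bnd_cst.
  - by move=> x y /=; rewrite !fctE scale0r addr0.
  - by rewrite (mf_cst 0 hmu) (mf_cst 0 hnu) addr0.
have tp : 0 < t by rewrite lt_neqAle eq_sym tn0.
rewrite -ler_pdivrMl//; apply: le_dual_cost => // f g bf bg h.
rewrite ler_pdivrMl//.
apply: (le_trans (@dual_cost_le _ (fun x => t * f x) (fun x => t * g x) _ _ _ _)).
- exact: bndZ.
- exact: bndZ.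
- exact: bndZ.
- by move=> x y; rewrite -mulrDr; have := ler_wpM2l t0 (h x y).
- by rewrite (mfZ hmu)// (mfZ hnu)//; lra.
Qed.

(** A linear functional below the covering cost is positive and has the marginals
    [mu] and [nu]; choosing it by Hahn-Banach to be extremal at [- c] makes the
    cost of [c] equal to the supremum of the dual problem. The marginals are
    tight, so this functional is a probability. *)
Theorem kantorovich (c : T -> T -> R) (B : R) :
  bnd (fun z : T * T => c z.1 z.2) ->
  (forall f g, bnd f -> bnd g -> (forall x y, f x - g y <= c x y) ->
    mean mu f - mean nu g <= B) ->
  exists pi : probability (discrete_pair T) R,
    [/\ forall A : set T, pi (fst @^-1` A) = mu A,
        forall A : set T, pi (snd @^-1` A) = nu A &
        (\int[pi]_z c z.1 z.2)%R <= B].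
Proof.
move=> bc hB.
have bDD (u v : T * T -> R) : bnd u -> bnd v -> bnd (u + v) := @bndD _ _ u v.
have bDZ (a : R) (u : T * T -> R) : bnd u -> bnd (a *: u) := @bndZ _ _ a u.
(* The cost enters with a minus sign: Hahn-Banach gives a value of the covering cost,
   which is an infimum, while the dual problem for c is a supremum. *)
pose nc : T * T -> R := fun z => - c z.1 z.2.
have bnc : bnd nc := bndN bc.
have [l [lD lZ lp lc]] := hahn_banach bDD bDZ bnc sublinear_dual_cost.
have lN u : bnd u -> l (fun z => - u z) = - l u.
  move=> bu; rewrite -[RHS]mulN1r -lZ//; congr l.
  by apply/funext => z; rewrite fctE scaleN1r.
have lle u f g : bnd u -> bnd f -> bnd g ->
    (forall x y, u (x, y) <= f x + g y) -> l u <= mean mu f + mean nu g.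
  by move=> bu bf bg h; apply: le_trans (lp _ bu) _; exact: dual_cost_le.
have lfst f : bnd f -> l (f \o fst) = mean mu f.
  move=> bf; have bff : bnd (f \o fst : T * T -> R) by have [M h] := bf; exists M => z; exact: h.
  have b0 : bnd (fun _ : T => 0 : R) by exact: bnd_cst.
  apply/le_anti/andP; split.
    have := lle _ f (fun=> 0) bff bf b0; rewrite (mf_cst 0 hnu) addr0; apply => x y /=.
    by rewrite addr0.
  rewrite -lerN2 -lN//.
  have := lle (fun z => - (f \o fst) z) (fun x => - f x) (fun=> 0) (bndN bff) (bndN bf) b0.
  rewrite (mf_cst 0 hnu) addr0 (mfN hmu)//.
  by apply => x y /=; rewrite addr0.
have lsnd f : bnd f -> l (f \o snd) = mean nu f.
  move=> bf; have bff : bnd (f \o snd : T * T -> R) by have [M h] := bf; exists M => z; exact: h.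
  have b0 : bnd (fun _ : T => 0 : R) by exact: bnd_cst.
  apply/le_anti/andP; split.
    have := lle _ (fun=> 0) f bff b0 bf; rewrite (mf_cst 0 hmu) add0r; apply => x y /=.
    by rewrite add0r.
  rewrite -lerN2 -lN//.
  have := lle (fun z => - (f \o snd) z) (fun=> 0) (fun x => - f x) (bndN bff) b0 (bndN bf).
  rewrite (mf_cst 0 hmu) add0r (mfN hnu)//.
  by apply => x y /=; rewrite add0r.
have hl : mean_functional l.
  split.
  - by move=> f g bf bg; exact: lD.
  - by move=> a f bf; exact: lZ.
  - move=> f g bf bg fg; rewrite -subr_le0 -lN// -lD//; last exact: bndN.
    have := lle (f + (fun z => - g z)) (fun=> 0) (fun=> 0).
    rewrite (mf_cst 0 hmu) (mf_cst 0 hnu) addr0; apply.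
    + exact: bndB.
    + exact: bnd_cst.
    + exact: bnd_cst.
    + by move=> x y; rewrite !fctE subr_le0.
  - have := @lfst (fun=> 1) (bnd_cst _ _); rewrite (mf_cst 1 hmu); exact.
have tight e : 0 < e -> exists K : set (discrete_pair T), finite_set K /\ l (\1_(~` K)) <= e.
  move=> e0; have e2 : 0 < e / 2 by lra.
  have [K [fK mK]] := countable_tight mT cT mu e2.
  have [K' [fK' mK']] := countable_tight mT cT nu e2.
  (* A pair outside K x K' has a coordinate outside K or outside K'. *)
  exists (K `*` K'); split; first exact: finite_setX.
  have := lle (\1_(~` (K `*` K'))) (\1_(~` K)) (\1_(~` K')).
  move=> /(_ (bnd_indic _ _) (bnd_indic _ _) (bnd_indic _ _)) h.
  suff : l \1_(~` (K `*` K')) <= mean mu (\1_(~` K)) + mean nu (\1_(~` K')) by lra.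
  apply: h => x y; rewrite !indicE -natrD ler_nat.
  have [Kx|Kx] := pselect (K x); last by rewrite (@mem_set _ (~` K) x Kx)//; case: (_ \in _).
  have [Ky|Ky] := pselect (K' y).
    by rewrite (@memNset _ (~` (K `*` K')))// => /(_ (conj Kx Ky)).
  rewrite (@mem_set _ (~` K') y Ky) addn1; by case: (_ \in _).
have mP (A : set (discrete_pair T)) : measurable A by [].
have [pi hpi] := mf_probability mP hl tight.
have pA (A : set (discrete_pair T)) : pi A = (l \1_A)%:E.
  rewrite hpi; last exact: bnd_indic.
  by rewrite mean_indic// fineK// fin_num_measure.
exists pi; split.
- move=> A; rewrite pA -[RHS]fineK ?fin_num_measure// -(mean_indic mT).
  by rewrite -lfst; last exact: bnd_indic.
- move=> A; rewrite pA -[RHS]fineK ?fin_num_measure// -(mean_indic mT).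
  by rewrite -lsnd; last exact: bnd_indic.
- rewrite -(hpi _ bc) -lerN2 -lN// -/nc lc; apply: le_dual_cost => // f g bf bg h.
  have := hB (fun x => - f x) g (bndN bf) bg; rewrite (mfN hmu)// => hh.
  suff : - mean mu f - mean nu g <= B by lra.
  by apply: hh => x y; have := h x y; rewrite /nc/=; lra.
Qed.

End Kantorovich.

(** * Absolutely convergent sums *)

Section AbsoluteSums.
Context (R : realType) (I : choiceType).
Implicit Types (f g h : I -> R).

Definition abs_summable f := summable [set: I] (EFin \o f).

Lemma asum_nonneg f : abs_summable f -> (forall i, 0 <= f i) ->
  (asum f)%:E = \esum_(i in [set: I]) (f i)%:E.
Proof.
move=> sf f0; rewrite /asum fineK.
  rewrite [X in (_ - X)%E]esum1; last first.
    by move=> i _; rewrite funenegE /= max_r // lee_fin oppr_le0.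
  by rewrite sube0; apply: eq_esum => i _; rewrite funeposE/= max_l// lee_fin.
rewrite fin_numB; apply/andP; split.
  rewrite fin_numElt (lt_le_trans (ltNyr 0)) ?esum_ge0//=.
  apply: le_lt_trans sf; apply: le_esum => i _.
  by rewrite funeposE /= ge_max !lee_fin ler_norm normr_ge0.
rewrite fin_numElt (lt_le_trans (ltNyr 0)) ?esum_ge0//=.
apply: le_lt_trans sf; apply: le_esum => i _.
by rewrite funenegE /= ge_max !lee_fin -normrN ler_norm normr_ge0.
Qed.

(** The form in which sums of nonnegative terms are estimated: only finite partial
    sums have to be considered. *)
Lemma summP f (c : R) : (forall i, 0 <= f i) ->
  (forall s : seq I, uniq s -> \sum_(i <- s) f i <= c) -> abs_summable f /\ asum f <= c.
Proof.
move=> f0 h.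
have le : (\esum_(i in [set: I]) (f i)%:E <= c%:E)%E.
  apply: ge_ereal_sup => _ [X [fX _] <-].
  have := h (fset_set X) (fset_uniq _).
  by rewrite -lee_fin -sumEFin fsbig_finite.
have sf : abs_summable f.
  rewrite /abs_summable /summable; under eq_esum do rewrite /= ger0_norm//.
  by rewrite (le_lt_trans le) ?ltry.
by split=> //; rewrite -lee_fin asum_nonneg.
Qed.

Lemma sum_le_asum f (s : seq I) : abs_summable f -> (forall i, 0 <= f i) -> uniq s ->
  \sum_(i <- s) f i <= asum f.
Proof.
move=> sf f0 us; rewrite -lee_fin asum_nonneg//; apply: esum_ge.
exists [set` s]; first by split.
by rewrite -sumEFin fsbig_seq.
Qed.

Lemma le_summ f g : (forall i, `|f i| <= g i) -> abs_summable g -> abs_summable f.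
Proof.
move=> fg; apply: le_lt_trans; apply: le_esum => i _ /=; rewrite lee_fin.
exact: le_trans (fg i) (ler_norm _).
Qed.

Lemma summD f g : abs_summable f -> abs_summable g -> abs_summable (fun i => f i + g i).
Proof. exact: summableD. Qed.

Lemma summN f : abs_summable f -> abs_summable (fun i => - f i).
Proof.
move=> sf; rewrite /abs_summable summableN; move: sf; congr summable.
by apply/funext => i /=; rewrite opprK.
Qed.

Lemma summ_norm f : abs_summable f -> abs_summable (fun i => `|f i|).
Proof.
by apply: le_lt_trans; apply: le_esum => i _ /=; rewrite normr_id.
Qed.

Lemma norm_summ f : abs_summable (fun i => `|f i|) -> abs_summable f.
Proof. by apply: le_summ. Qed.

Lemma summZ a f : abs_summable f -> abs_summable (fun i => a * f i).
Proof.
move=> /summ_norm sf; apply: norm_summ.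
apply: (proj1 (@summP _ (`|a| * asum (fun i => `|f i|)) (fun=> normr_ge0 _) _)).
move=> s us; under eq_bigr do rewrite normrM.
by rewrite -mulr_sumr ler_wpM2l// sum_le_asum.
Qed.

Lemma asumBn f g : abs_summable f -> abs_summable g -> (forall i, 0 <= f i) ->
  (forall i, 0 <= g i) -> asum (fun i => f i - g i) = asum f - asum g.
Proof.
move=> sf sg f0 g0; rewrite {1}/asum.
have := @esumB _ _ setT _ _ sf sg (fun i _ => f0 i) (fun i _ => g0 i).
rewrite -!asum_nonneg// -EFinB => H.
by rewrite -[RHS]/(fine (asum f - asum g)%:E) -H.
Qed.

Lemma asumDn f g : abs_summable f -> abs_summable g -> (forall i, 0 <= f i) ->
  (forall i, 0 <= g i) -> asum (fun i => f i + g i) = asum f + asum g.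
Proof.
move=> sf sg f0 g0; apply: EFin_inj; rewrite EFinD !asum_nonneg//.
- by rewrite -esumD// => i _; rewrite lee_fin.
- exact: summD.
- by move=> i; rewrite addr_ge0.
Qed.

Let pos f i := Num.max (f i) 0.
Let neg f i := Num.max (- f i) 0.

Let pos_ge0 f i : 0 <= pos f i. Proof. by rewrite le_max lexx orbT. Qed.
Let neg_ge0 f i : 0 <= neg f i. Proof. by rewrite le_max lexx orbT. Qed.

Let spos f : abs_summable f -> abs_summable (pos f).
Proof.
move=> /summ_norm; apply: le_summ => i.
by rewrite ger0_norm// ge_max ler_norm normr_ge0.
Qed.

Let sneg f : abs_summable f -> abs_summable (neg f).
Proof.
move=> /summ_norm; apply: le_summ => i.
by rewrite ger0_norm// ge_max -normrN ler_norm normr_ge0.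
Qed.

Let posneg f i : f i = pos f i - neg f i.
Proof. by rewrite /pos /neg; have [?|?] := leP (f i) 0; have [?|?] := leP (- f i) 0; lra. Qed.

Let asumE f : abs_summable f -> asum f = asum (pos f) - asum (neg f).
Proof.
move=> sf; rewrite -asumBn//; [|exact: spos|exact: sneg].
by congr asum; apply/funext => i; exact: posneg.
Qed.

Lemma asumD f g : abs_summable f -> abs_summable g -> asum (fun i => f i + g i) = asum f + asum g.
Proof.
move=> sf sg; rewrite (asumE sf) (asumE sg).
have -> : (fun i => f i + g i) = (fun i => (pos f i + pos g i) - (neg f i + neg g i)).
  by apply/funext => i; rewrite (posneg f) (posneg g); lra.
rewrite asumBn.
- by rewrite !asumDn//; [lra|exact: sneg|exact: sneg|exact: spos|exact: spos].
- exact: summD (spos sf) (spos sg).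
- exact: summD (sneg sf) (sneg sg).
- by move=> i; rewrite addr_ge0.
- by move=> i; rewrite addr_ge0.
Qed.

Lemma asum_ge0 f : abs_summable f -> (forall i, 0 <= f i) -> 0 <= asum f.
Proof. by move=> sf f0; have := @sum_le_asum f [::] sf f0 isT; rewrite big_nil. Qed.

Lemma summ_cst0 : abs_summable (fun=> 0).
Proof.
by apply: (proj1 (@summP (fun=> 0) 0 (fun=> lexx 0) _)) => s _; rewrite big1.
Qed.

Lemma asum_cst0 : asum (fun _ : I => 0 : R) = 0.
Proof.
apply/le_anti; rewrite asum_ge0 ?andbT//; last exact: summ_cst0.
by apply: (proj2 (@summP (fun=> 0) 0 (fun=> lexx 0) _)) => s _; rewrite big1.
Qed.

Lemma asumN f : abs_summable f -> asum (fun i => - f i) = - asum f.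
Proof.
move=> sf; have := asumD sf (summN sf).
rewrite (_ : (fun i => f i + - f i) = fun=> 0).
  by rewrite asum_cst0; lra.
by apply/funext => i; rewrite subrr.
Qed.

Lemma le_asum f g : abs_summable f -> abs_summable g -> (forall i, f i <= g i) -> asum f <= asum g.
Proof.
move=> sf sg fg; rewrite -subr_ge0 -(asumN sf) -asumD//; last exact: summN.
apply: asum_ge0; first exact: summD sg (summN sf).
by move=> i; rewrite subr_ge0.
Qed.

Lemma asumZ a f : abs_summable f -> asum (fun i => a * f i) = a * asum f.
Proof.
move=> sf.
have pZ b g : 0 <= b -> abs_summable g -> (forall i, 0 <= g i) ->
    asum (fun i => b * g i) = b * asum g.
  move=> b0 sg g0; apply/le_anti/andP; split.
    apply: (proj2 (@summP _ (b * asum g) (fun i => mulr_ge0 b0 (g0 i)) _)).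
    by move=> s us; rewrite -mulr_sumr ler_wpM2l// sum_le_asum.
  have [->|bn0] := eqVneq b 0.
    by rewrite mul0r; apply: asum_ge0; [exact: summZ|move=> i; rewrite mul0r].
  have bp : 0 < b by rewrite lt_neqAle eq_sym bn0.
  rewrite -ler_pdivlMl//.
  apply: (proj2 (@summP _ (b^-1 * asum (fun i => b * g i)) g0 _)) => s us.
  rewrite ler_pdivlMl// mulr_sumr; apply: (@sum_le_asum (fun i => b * g i)) => //.
    exact: summZ.
  by move=> i; rewrite mulr_ge0.
have Z b : 0 <= b -> asum (fun i => b * f i) = b * asum f.
  move=> b0; rewrite (asumE sf).
  have -> : (fun i => b * f i) = (fun i => b * pos f i - b * neg f i).
    by apply/funext => i; rewrite (posneg f); lra.
  have sp := spos sf; have sn := sneg sf.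
  rewrite asumBn; first by rewrite !pZ//; lra.
  - exact: summZ.
  - exact: summZ.
  - by move=> i; rewrite mulr_ge0.
  - by move=> i; rewrite mulr_ge0.
have [/Z//|a0] := leP 0 a.
have -> : (fun i => a * f i) = (fun i => - ((- a) * f i)).
  by apply/funext => i; lra.
by rewrite asumN; [rewrite Z; lra|exact: summZ].
Qed.

Lemma asumB f g : abs_summable f -> abs_summable g -> asum (fun i => f i - g i) = asum f - asum g.
Proof. by move=> sf sg; rewrite asumD ?asumN//; exact: summN. Qed.

Lemma delta_summ (x : I) (c : R) :
  abs_summable (fun i => c * (i == x)%:R) /\ asum (fun i => c * (i == x)%:R) = c.
Proof.
have h : abs_summable (fun i => (i == x)%:R : R) /\ asum (fun i => (i == x)%:R : R) <= 1.
  apply: summP => [i|s us]; first exact: ler0n.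
  have [xs|xs] := boolP (x \in s).
    by rewrite (bigD1_seq x)//= eqxx big1 ?addr0// => i /negPf ->.
  rewrite big_seq big1 ?ler01// => i is_; case: eqP => // ix.
  by rewrite ix in is_; rewrite is_ in xs.
have [sd d1] := h.
have d2 := @sum_le_asum _ [:: x] sd (fun i => ler0n _ _) isT.
rewrite big_seq1 eqxx in d2.
rewrite asumZ//; split; first exact: summZ.
by rewrite (_ : asum _ = 1) ?mulr1//; apply/le_anti; rewrite d1 d2.
Qed.

Lemma asum_bigsum (J : Type) (r : seq J) (F : J -> I -> R) : (forall j, abs_summable (F j)) ->
  abs_summable (fun i => \sum_(j <- r) F j i) /\
  asum (fun i => \sum_(j <- r) F j i) = \sum_(j <- r) asum (F j).
Proof.
move=> sF; elim: r => [|j r [IH1 IH2]].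
  have -> : (fun i => \sum_(j <- [::]) F j i) = (fun=> 0).
    by apply/funext => i; rewrite big_nil.
  by rewrite big_nil asum_cst0; split=> //; exact: summ_cst0.
have -> : (fun i => \sum_(j <- j :: r) F j i) = (fun i => F j i + \sum_(j <- r) F j i).
  by apply/funext => i; rewrite big_cons.
by rewrite big_cons -IH2 -asumD//; split => //; exact: summD.
Qed.

End AbsoluteSums.

(** * Recurrence excludes explosion *)

Section Rates.
Context (R : realType) (F : pointedType) (Q : F -> F -> R).
Hypothesis rateQ : rate_matrix Q.
Implicit Types (i j : F) (u : F -> R).

(** A jump from a site to itself changes nothing, so generators only see these
    rates. *)
Definition jump_rate i j : R := if j == i then 0 else Q i j.

Lemma jump_rate_ge0 i j : 0 <= jump_rate i j.
Proof.
rewrite /jump_rate; case: eqVneq => // ji; apply: rateQ.1; by rewrite eq_sym.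
Qed.

Let esum_jump_rate i : (\esum_(j in [set: F]) (jump_rate i j)%:E = (- Q i i)%:E)%E.
Proof.
rewrite -(rateQ.2 i) [RHS]esum_mkcond; apply: eq_esum => j _.
rewrite /jump_rate; case: eqVneq => [->|ji].
  by rewrite memNset//= eqxx.
by rewrite mem_set.
Qed.

Lemma summ_jump_rate i : abs_summable (jump_rate i).
Proof.
rewrite /abs_summable /summable; under eq_esum do rewrite /= ger0_norm ?jump_rate_ge0//.
by rewrite esum_jump_rate ltry.
Qed.

Lemma asum_jump_rate i : asum (jump_rate i) = - Q i i.
Proof.
apply: EFin_inj; rewrite asum_nonneg ?esum_jump_rate//; first exact: summ_jump_rate.
exact: jump_rate_ge0.
Qed.

Lemma exit_rate_ge0 i : 0 <= - Q i i.
Proof. by rewrite -asum_jump_rate asum_ge0//; [exact: summ_jump_rate|exact: jump_rate_ge0]. Qed.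

Lemma summ_jump_rate_bounded i u M : (forall j, `|u j| <= M) ->
  abs_summable (fun j => jump_rate i j * u j).
Proof.
move=> uM; apply: (@le_summ _ _ _ (fun j => M * jump_rate i j)).
  by move=> j; rewrite normrM (ger0_norm (jump_rate_ge0 _ _)) mulrC ler_wpM2r// jump_rate_ge0.
exact/summZ/summ_jump_rate.
Qed.

Lemma jump_rate_absorbing i j : Q i i = 0 -> jump_rate i j = 0.
Proof.
move=> Q0; apply/le_anti; rewrite jump_rate_ge0 andbT.
have := @sum_le_asum _ _ _ [:: j] (summ_jump_rate i) (jump_rate_ge0 i) isT.
by rewrite big_seq1 asum_jump_rate Q0 oppr0.
Qed.

Lemma jump_matrix_rate i j : jump_matrix Q i j * - Q i i = jump_rate i j.
Proof.
rewrite /jump_matrix /jump_rate eq_sym; have [_|ji] := eqVneq j i.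
  by have [->|_] := eqVneq (Q i i) 0; rewrite ?oppr0 ?mulr0 ?mul0r.
have [Q0|Q0] := eqVneq (Q i i) 0; last by rewrite divfK// oppr_eq0.
by rewrite mul0r; have := jump_rate_absorbing j Q0; rewrite /jump_rate (negPf ji).
Qed.

Lemma jump_matrix_delta i : Q i i = 0 ->
  jump_matrix Q i = fun j => 1 * (j == i)%:R.
Proof.
move=> Q0; apply/funext => j; rewrite /jump_matrix Q0 eqxx eq_sym.
by case: eqVneq => _; rewrite mul1r.
Qed.

Lemma jump_matrix_moving i : Q i i != 0 ->
  jump_matrix Q i = fun j => (- Q i i)^-1 * jump_rate i j.
Proof.
move=> Q0; apply/funext => j; rewrite -jump_matrix_rate mulrC mulfK//.
by rewrite oppr_eq0.
Qed.

Lemma jump_matrix_prob i : [/\ forall j, 0 <= jump_matrix Q i j,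
  abs_summable (jump_matrix Q i) & asum (jump_matrix Q i) = 1].
Proof.
have [Q0|Q0] := eqVneq (Q i i) 0.
  rewrite jump_matrix_delta//; have [? ?] := delta_summ i (1 : R); split=> //.
rewrite jump_matrix_moving//; split.
- by move=> j; rewrite mulr_ge0 ?jump_rate_ge0// invr_ge0 exit_rate_ge0.
- exact/summZ/summ_jump_rate.
- by rewrite asumZ ?asum_jump_rate ?mulVf ?oppr_eq0//; exact: summ_jump_rate.
Qed.

Lemma summ_jump_bounded i u M : (forall j, `|u j| <= M) ->
  abs_summable (fun j => jump_matrix Q i j * u j).
Proof.
have [p0 ps _] := jump_matrix_prob i.
move=> uM; apply: (@le_summ _ _ _ (fun j => M * jump_matrix Q i j)).
  by move=> j; rewrite normrM (ger0_norm (p0 _)) mulrC ler_wpM2r.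
exact: summZ.
Qed.

Section Taboo.
Variable i : F.

(** The probability that the jump chain from a given site avoids [i] at its first
    n steps, computed from the transition matrix alone. *)
Fixpoint avoid (n : nat) : F -> R :=
  if n is n'.+1 then
    fun j => asum (fun k => jump_matrix Q j k * ((k != i)%:R * avoid n' k))
  else fun=> 1.

Lemma avoid_bnd n j : 0 <= avoid n j <= 1.
Proof.
elim: n j => [|n IH] j /=; first by rewrite ler01 lexx.
have [p0 ps p1] := jump_matrix_prob j.
have b k : `|((k != i)%:R * avoid n k : R)| <= 1.
  have /andP[a0 a1] := IH k; rewrite ger0_norm ?mulr_ge0//.
  by case: (k != i); rewrite ?mul1r ?mul0r ?ler01.
apply/andP; split.
  apply: asum_ge0; first exact: summ_jump_bounded b.
  by move=> k; have /andP[a0 a1] := IH k; rewrite !mulr_ge0.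
rewrite -[leRHS]p1; apply: le_asum => //; first exact: summ_jump_bounded b.
by move=> k; rewrite ler_piMr//; apply: le_trans (b k); exact: ler_norm.
Qed.

Lemma summ_avoid n j : abs_summable (fun k => jump_matrix Q j k * ((k != i)%:R * avoid n k)).
Proof.
apply: (@summ_jump_bounded _ _ 1) => k.
have /andP[a0 a1] := avoid_bnd n k; rewrite ger0_norm ?mulr_ge0//.
by case: (k != i); rewrite ?mul1r ?mul0r ?ler01.
Qed.

Section Chain.
Context d (Om : measurableType d) (P : probability Om R)
  (Y : nat -> Om -> F) (S : nat -> Om -> \bar R).
Hypothesis YS : jump_chain_holding_times Q i P Y S.
Local Notation p A := (fine (P A)).

Let mY k (A : set F) : measurable (Y k @^-1` A).
Proof. by case: YS. Qed.

(** The positivity of the holding times is part of the event because the law of the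
    chain is given through events of the form s < S k, here with s = 0. *)
Definition cylinder m (y : nat -> F) : set Om :=
  [set w | forall k, (k <= m)%N -> Y k w = y k /\ (0%:E < S k w)%E].

Definition taboo m n : set Om :=
  [set w | forall k, (m < k <= m + n)%N -> Y k w != i].

Let measurable_bounded (B : nat -> set Om) (D : pred nat) n :
  (forall k, measurable (B k)) -> measurable [set w | forall k, D k -> (k <= n)%N -> B k w].
Proof.
move=> mB; rewrite (_ : [set w | _] =
   \bigcap_(k in [set k | D k && (k <= n)%N]) B k); last first.
  apply/seteqP; split=> w h k /=; first by move=> /andP[Dk kn]; exact: h.
  by move=> Dk kn; apply: h; rewrite /= Dk.
exact: bigcap_measurableType.
Qed.

Lemma measurable_cylinder m y : measurable (cylinder m y).
Proof.
have := @measurable_bounded (fun k => Y k @^-1` [set y k] `&` [set w | (0%:E < S k w)%E])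
  predT m; rewrite (_ : [set w | _] = cylinder m y); last first.
  by apply/seteqP; split=> w h k; [move=> km; exact: h|move=> _ km; exact: h].
apply=> k; apply: measurableI; first exact: mY.
have [_ mS _ _] := YS; rewrite -[X in measurable X]setTI.
by apply: emeasurable_fun_o_infty => //; exact: mS.
Qed.

Lemma measurable_taboo m n : measurable (taboo m n).
Proof.
have := @measurable_bounded (fun k => Y k @^-1` [set~ i])
  (fun k => (m < k)%N) (m + n)%N; rewrite (_ : [set w | _] = taboo m n); last first.
  apply/seteqP; split=> w h k; first by move=> /andP[mk kn]; apply/eqP; exact: h.
  by move=> mk kn; apply/eqP; apply: h; rewrite mk.
by apply=> k; exact: mY.
Qed.

Lemma cylinder_prob m y : p (cylinder m y) =
  (y 0%N == i)%:R * \prod_(k < m) jump_matrix Q (y k) (y k.+1).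
Proof.
have [_ _ _ h] := YS; have := h m y (fun=> 0) (fun=> lexx _) => /(congr1 fine) /=.
rewrite -/(cylinder m y) => ->; rewrite [X in _ * _ * X]big1 ?mulr1//.
by move=> k _; rewrite mulr0 expR0.
Qed.

Let p_ge0 A : 0 <= p A. Proof. by rewrite fine_ge0. Qed.

Let p_le A B : measurable A -> measurable B -> A `<=` B -> p A <= p B.
Proof.
move=> mA mB AB; apply: fine_le; [exact: fin_num_measure|exact: fin_num_measure|].
by apply: le_measure => //; exact: mem_set.
Qed.

Let p_sum m (s : seq F) (B : set Om) : measurable B -> uniq s ->
  \sum_(k <- s) p (B `&` Y m @^-1` [set k]) <= p B.
Proof.
move=> mB us; have mBs A : measurable (B `&` Y m @^-1` A) by apply: measurableI.
suff <- : p (B `&` Y m @^-1` [set` s]) = \sum_(k <- s) p (B `&` Y m @^-1` [set k]).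
  by apply: p_le => // w [].
elim: s us => [_|k s IH /= /andP[ks us]].
  rewrite big_nil (_ : _ `&` _ = set0) ?measure0//.
  by rewrite -subset0 => w [_]; rewrite /= in_nil.
rewrite big_cons -IH// -fineD ?fin_num_measure// -measureU//; last first.
  by rewrite -subset0 => w [[_ /= Yk] [_ /=]]; rewrite Yk (negPf ks).
congr (fine (P _)); apply/seteqP; split => w.
  by move=> [Bw] /=; rewrite in_cons => /orP[/eqP|]; [left|right].
by move=> [[Bw /= Yk]|[Bw /= Yk]]; split=> //=; rewrite in_cons ?Yk ?eqxx// orbT.
Qed.

(** The first step splits the event according to the next site. The finite
    partial sums over that site are bounded, hence only an inequality. *)
Lemma avoid_le_taboo n m y :
  p (cylinder m y) * avoid n (y m) <= p (cylinder m y `&` taboo m n).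
Proof.
elim: n m y => [|n IH] m y /=.
  rewrite mulr1; apply: p_le.
  - exact: measurable_cylinder.
  - by apply: measurableI; [exact: measurable_cylinder|exact: measurable_taboo].
  - move=> w cw; split=> // k; rewrite addn0 => /andP[mk km].
    by move: (leq_trans mk km); rewrite ltnn.
rewrite -asumZ; last exact: summ_avoid.
have [p0 _ _] := jump_matrix_prob (y m).
have a0 k := proj1 (andP (avoid_bnd n k)).
apply: (proj2 (@summP _ _ _ _ _ _)) => [k|s us]; first by rewrite !mulr_ge0.
have mct : measurable (cylinder m y `&` taboo m n.+1).
  by apply: measurableI; [exact: measurable_cylinder|exact: measurable_taboo].
apply: le_trans (p_sum m.+1 mct us); apply: ler_sum => k _.
have [->|ki] := eqVneq k i; first by rewrite mul0r !mulr0.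
rewrite mul1r mulrA.
(* The path y continued by one step to k. *)
pose y' l := if (l <= m)%N then y l else k.
have -> : p (cylinder m y) * jump_matrix Q (y m) k = p (cylinder m.+1 y').
  rewrite !cylinder_prob /y' /= -mulrA big_ord_recr/= leqnn ltnn; congr (_ * (_ * _)).
  by apply: eq_bigr => l _; rewrite (ltnW (ltn_ord l)) ltn_ord.
have := IH m.+1 y'; rewrite {2}/y' ltnn => /le_trans; apply; apply: p_le.
- by apply: measurableI; [exact: measurable_cylinder|exact: measurable_taboo].
- exact: measurableI.
- move=> w [cw tw].
  have Yk : Y m.+1 w = k by rewrite (cw m.+1 (leqnn _)).1 /y' ltnn.
  split; last by [].
  split=> [l lm|l /andP[ml lmn]].
    by have := cw l (leqW lm); rewrite /y' lm.
  move: ml; rewrite leq_eqVlt => /orP[/eqP <-|ml]; first by rewrite Yk.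
  by apply: tw; rewrite ml addSn -addnS.
Qed.

Lemma avoid_le_taboo0 n : avoid n i <= p (taboo 0 n).
Proof.
have := avoid_le_taboo n 0 (fun=> i); rewrite cylinder_prob eqxx big_ord0 !mul1r.
move=> /le_trans; apply; apply: p_le; [|exact: measurable_taboo|by move=> w []].
by apply: measurableI; [exact: measurable_cylinder|exact: measurable_taboo].
Qed.

(** On the event of no return the return time is infinite, so this event is null
    when the expected return time is finite. *)
Lemma taboo_cvg0 : (\int[P]_w return_time Y S i w < +oo)%E ->
  p (taboo 0 n) @[n --> \oo] --> 0.
Proof.
move=> Ifin; pose N := \bigcap_n taboo 0 n.
have mN : measurable N by apply: bigcap_measurableType => n _; exact: measurable_taboo.
have rt0 w : (0 <= return_time Y S i w)%E.
  apply: le_ereal_inf_tmp => _ [n _ <-]; apply: sume_ge0 => k _.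
  by have [_ _ S0 _] := YS.
have NE w : N w -> return_time Y S i w = +oo%E.
  move=> Nw; rewrite /return_time (_ : [set _ | _ in _] = set0) ?ereal_inf0//.
  rewrite -subset0 => _ [n [n0 Yn] <-].
  by have := Nw n I n; rewrite n0 add0n leqnn Yn eqxx => /(_ isT).
have lb (M : R) : 0 <= M -> (M%:E * P N <= \int[P]_w return_time Y S i w)%E.
  move=> M0; have -> : (M%:E * P N = \int[P]_w (M%:E * (\1_N w)%:E))%E.
    rewrite ge0_integralZl//; last by apply/measurable_EFinP.
    by rewrite integral_indic// setIT.
  rewrite ge0_integralTE; last by move=> w; rewrite mule_ge0// lee_fin.
  rewrite [leRHS]ge0_integralTE//; apply: le_ereal_sup => _ [h hM <-].
  exists h => // w; apply: le_trans (hM w) _.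
  rewrite indicE; case wN: (w \in N); last by rewrite mule0.
  by rewrite NE ?leey//; exact: set_mem.
have PN0 : P N = 0.
  move: (@lee_fin R 0 0); have /fineK <- : (P N) \is a fin_num by exact: fin_num_measure.
  move=> _; congr EFin; apply/eqP; apply: contraT => pN.
  have pN0 : 0 < fine (P N) by rewrite lt_neqAle eq_sym pN fine_ge0.
  have I0 : (0 <= \int[P]_w return_time Y S i w)%E by exact: integral_ge0.
  have Ifn : (\int[P]_w return_time Y S i w)%E \is a fin_num by rewrite ge0_fin_numE.
  pose J := fine (\int[P]_w return_time Y S i w)%E.
  have J0 : 0 <= J by exact: fine_ge0.
  have := lb ((J + 1) / fine (P N)) _; rewrite divr_ge0//; last by lra.
  move=> /(_ isT); rewrite -(fineK Ifn) -[P N]fineK ?fin_num_measure//.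
  by rewrite -EFinM lee_fin divfK// -/J; lra.
have : P \o taboo 0 @ \oo --> P N.
  apply: nonincreasing_cvg_mu => //.
  - by rewrite (le_lt_trans (probability_le1 _ _)) ?ltry//; exact: measurable_taboo.
  - by move=> n; exact: measurable_taboo.
  - move=> m n mn; apply/subsetPset => w tw k /andP[k0 km].
    by apply: tw; rewrite k0 (leq_trans km)// !add0n.
by rewrite PN0 => /fine_cvgP[_].
Qed.

End Chain.
End Taboo.

(** Since u <= 1, stopping the chain at time n or at its first visit to [i] gives
    [u j <= u i + avoid i n j]. At [i] itself the hypothesis has the additional
    factor q / (1 + q) < 1, where q is the exit rate; as the chain returns to [i],
    letting n tend to infinity leaves (1 + q) u i <= q u i. *)
Lemma subsolution0 (u : F -> R) : positive_recurrent Q ->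
  (forall j, 0 <= u j <= 1) ->
  (forall j, (1 - Q j j) * u j <= asum (fun k => jump_rate j k * u k)) ->
  forall i, u i = 0.
Proof.
move=> precQ u01 usub i; apply/le_anti; rewrite (proj1 (andP (u01 i))) andbT.
have ub k : `|u k| <= 1 by have /andP[? ?] := u01 k; rewrite ger0_norm.
have absorb j : Q j j = 0 -> u j <= 0.
  move=> Q0; have := usub j; rewrite Q0 subr0 mul1r => /le_trans; apply.
  rewrite (_ : (fun k => _) = fun=> 0) ?asum_cst0//.
  by apply/funext => k; rewrite jump_rate_absorbing// mul0r.
have [Q0|[d [Om [P [Y [S [YS Ifin]]]]]]] := precQ i; first exact: absorb.
have step j : u j <= asum (fun k => jump_matrix Q j k * u k).
  have [p0 ps p1] := jump_matrix_prob j.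
  have sju := @summ_jump_bounded j u 1 ub.
  have a0 : 0 <= asum (fun k => jump_matrix Q j k * u k).
    apply: asum_ge0 => // k; rewrite mulr_ge0//; by have /andP[] := u01 k.
  have [Q0|Q0] := eqVneq (Q j j) 0; first exact: le_trans (absorb _ Q0) a0.
  have q0 : 0 < - Q j j by rewrite lt_neqAle exit_rate_ge0 andbT eq_sym oppr_eq0.
  have : - Q j j * u j <= - Q j j * asum (fun k => jump_matrix Q j k * u k).
    rewrite -asumZ//; under eq_fun do rewrite mulrA [_ * jump_matrix _ _ _]mulrC jump_matrix_rate.
    apply: le_trans (usub j).
    by rewrite ler_wpM2r//; [have /andP[] := u01 j|lra].
  by rewrite ler_pM2l.
have hitting n j : u j <= u i + avoid i n j.
  elim: n j => [|n IH] j /=.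
    by have /andP[? ?] := u01 j; have /andP[? ?] := u01 i; lra.
  have [p0 ps p1] := jump_matrix_prob j.
  apply: (le_trans (step j)).
  have -> : u i + asum (fun k => jump_matrix Q j k * ((k != i)%:R * avoid i n k)) =
     asum (fun k => u i * jump_matrix Q j k + jump_matrix Q j k * ((k != i)%:R * avoid i n k)).
    rewrite asumD; [|exact: summZ|exact: summ_avoid].
    by rewrite asumZ// p1 mulr1.
  apply: le_asum.
  - exact: summ_jump_bounded ub.
  - by apply: summD; [exact: summZ|exact: summ_avoid].
  - move=> k; rewrite [u i * _]mulrC -mulrDr ler_wpM2l//.
    by case: eqVneq => [->|_]; rewrite ?mul0r ?addr0// mul1r.
have [p0 ps p1] := jump_matrix_prob i.
have uq n : u i <= - Q i i * avoid i n.+1 i.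
  have h : (1 - Q i i) * u i <= - Q i i * (u i + avoid i n.+1 i).
    apply: (le_trans (usub i)).
    have sa : abs_summable (fun k => jump_rate i k * avoid i n k).
      apply: (@summ_jump_rate_bounded _ _ 1) => k; have /andP[? ?] := avoid_bnd i n k.
      by rewrite ger0_norm.
    have -> : - Q i i * (u i + avoid i n.+1 i) = asum (fun k => - Q i i *
        (u i * jump_matrix Q i k + jump_matrix Q i k * ((k != i)%:R * avoid i n k))).
      rewrite asumZ; last by apply: summD; [exact: summZ|exact: summ_avoid].
      rewrite asumD; [|exact: summZ|exact: summ_avoid].
      by rewrite asumZ// p1 mulr1.
    apply: le_asum.
    - exact: summ_jump_rate_bounded ub.
    - by apply: summZ; apply: summD; [exact: summZ|exact: summ_avoid].
    - move=> k; rewrite [u i * _]mulrC -mulrDr mulrA [_ * jump_matrix _ _ _]mulrC jump_matrix_rate.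
      rewrite ler_wpM2l ?jump_rate_ge0//.
      by case: eqVneq => [->|_]; rewrite ?mul0r ?addr0// mul1r hitting.
  by lra.
have cv : - Q i i * avoid i n.+1 i @[n --> \oo] --> - Q i i * 0.
  apply: cvgM; first exact: cvg_cst.
  rewrite (cvg_shiftS (fun n => avoid i n i)).
  apply: (@squeeze_cvgr _ _ _ _ (fun=> 0) (fun n => fine (P (taboo i Y 0 n)))).
  - by apply: nearW => n; rewrite (avoid_le_taboo0 YS) andbT; have /andP[] := avoid_bnd i n i.
  - exact: cvg_cst.
  - exact: taboo_cvg0 YS Ifin.
rewrite -(mulr0 (- Q i i)); apply: (cvgr_to_ge cv).
by apply: nearW => n; exact: uq.
Qed.

End Rates.

(** * A Lyapunov function on the sites *)

Section Lyapunov.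
Context (R : realType) (F : pointedType) (Q : F -> F -> R).
Hypothesis rateQ : rate_matrix Q.
Hypothesis precQ : positive_recurrent Q.
Context (e : F -> nat) (injective_e : injective e).
Implicit Types (i j : F).

Local Notation out := (jump_rate Q).
Let out_ge0 := jump_rate_ge0 rateQ.

(** An upper bound, decreasing in m, for the expectation of exp (- T), where T is
    the exit time from the set of sites numbered below m. Enlarging the set
    and iterating the one-step equation are done with the same index, so that no
    fixed point has to be solved for each m. *)
Fixpoint exit_laplace (m : nat) : F -> R :=
  if m is m'.+1 then
    fun i => if (e i <= m')%N
             then asum (fun j => out i j * exit_laplace m' j) / (1 - Q i i) else 1
  else fun=> 1.
Local Notation v := exit_laplace.

Lemma exit_laplaceS m i : v m.+1 i =
  if (e i <= m)%N then asum (fun j => out i j * v m j) / (1 - Q i i) else 1.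
Proof. by []. Qed.

Arguments exit_laplace : simpl never.

Let q1_gt0 i : 0 < 1 - Q i i.
Proof. by have := exit_rate_ge0 rateQ i; lra. Qed.

Lemma exit_laplace_bnd m i : 0 <= v m i <= 1.
Proof.
elim: m i => [|m IH] i; first by rewrite ler01 lexx.
rewrite exit_laplaceS; case: ifP => _; last by rewrite ler01 lexx.
have b j : `|v m j| <= 1 by have /andP[? ?] := IH j; rewrite ger0_norm.
have sv := summ_jump_rate_bounded rateQ i b.
apply/andP; split.
  apply: divr_ge0; last exact: ltW.
  by apply: asum_ge0 => // j; rewrite mulr_ge0//; have /andP[] := IH j.
rewrite ler_pdivrMr// mul1r.
have : asum (fun j => out i j * v m j) <= asum (out i).
  apply: le_asum => //; first exact: summ_jump_rate.
  by move=> j; rewrite ler_piMr//; have /andP[] := IH j.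
by rewrite (asum_jump_rate rateQ); lra.
Qed.

Let v_norm m j : `|v m j| <= 1.
Proof. by have /andP[? ?] := exit_laplace_bnd m j; rewrite ger0_norm. Qed.

Lemma summ_exit m i : abs_summable (fun j => out i j * v m j).
Proof. exact (summ_jump_rate_bounded rateQ i (v_norm m)). Qed.

Lemma exit_laplace_noninc m i : v m.+1 i <= v m i.
Proof.
elim: m i => [|m IH] i; first by have /andP[] := exit_laplace_bnd 1 i.
rewrite [leRHS]exit_laplaceS; case: ifP => im; last by have /andP[] := exit_laplace_bnd m.+2 i.
rewrite exit_laplaceS (leqW im) ler_pM2r ?invr_gt0//.
apply: le_asum; [exact: summ_exit|exact: summ_exit|].
by move=> j; rewrite ler_wpM2l//; exact: IH.
Qed.

Lemma exit_laplace_super m i : asum (fun j => out i j * v m j) <= (1 - Q i i) * v m i.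
Proof.
have out_le m' : asum (fun j => out i j * v m' j) <= 1 - Q i i.
  have : asum (fun j => out i j * v m' j) <= asum (out i).
    apply: le_asum; [exact: summ_exit|exact: summ_jump_rate|].
    by move=> j; rewrite ler_piMr//; have /andP[] := exit_laplace_bnd m' j.
  by rewrite (asum_jump_rate rateQ); lra.
case: m => [|m]; first by rewrite mulr1.
rewrite [in leRHS]exit_laplaceS; case: ifP => im; last by rewrite mulr1.
rewrite [leRHS]mulrC divfK ?gt_eqF//.
apply: le_asum; [exact: summ_exit|exact: summ_exit|].
by move=> j; rewrite ler_wpM2l//; exact: exit_laplace_noninc.
Qed.

Lemma exit_laplace_out m i : (m <= e i)%N -> v m i = 1.
Proof. by case: m => [//|m] mi; rewrite exit_laplaceS leqNgt mi. Qed.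

(** The decreasing limit u satisfies the hypothesis of [subsolution0]. The exchange
    of limit and sum over the sites is monotone convergence for 1 - v, one finite
    partial sum at a time. *)
Lemma exit_laplace_cvg0 i : v m i @[m --> \oo] --> 0.
Proof.
have ni j : nonincreasing_seq (fun m => v m j).
  by apply/nonincreasing_seqP => m; exact: exit_laplace_noninc.
have lb j : has_lbound (range (fun m => v m j)).
  by exists 0 => _ [m _ <-]; have /andP[] := exit_laplace_bnd m j.
pose u j := limn (fun m => v m j).
have cu j : v m j @[m --> \oo] --> u j by exact: nonincreasing_is_cvgn.
have u_le m j : u j <= v m j by apply: nonincreasing_cvgn_ge => //; exact: cu.
have u_ge0 j : 0 <= u j.
  by apply: (cvgr_to_ge (cu j)); apply: nearW => m; have /andP[] := exit_laplace_bnd m j.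
have u01 j : 0 <= u j <= 1.
  by rewrite u_ge0 (le_trans (u_le 0 j))//; have /andP[] := exit_laplace_bnd 0 j.
suff u0 : forall i, u i = 0 by have := cu i; rewrite u0.
move=> {}i; apply: (subsolution0 rateQ precQ u01) => {}i.
have un j : `|u j| <= 1 by have /andP[? ?] := u01 j; rewrite ger0_norm.
have su := summ_jump_rate_bounded rateQ i un.
suff : asum (fun j => out i j * (1 - u j)) <= - Q i i - (1 - Q i i) * u i.
  rewrite (_ : (fun j => _) = fun j => out i j - out i j * u j); last first.
    by apply/funext => j; rewrite mulrBr mulr1.
  rewrite asumB ?asum_jump_rate//; [lra|exact: summ_jump_rate].
apply: (proj2 (@summP _ _ _ _ _ _)) => [j|s us].
  by rewrite mulr_ge0// subr_ge0; have /andP[] := u01 j.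
have c : \sum_(j <- s) out i j * (1 - v m j) @[m --> \oo] -->
         \sum_(j <- s) out i j * (1 - u j).
  apply: cvg_big; first exact: add_continuous.
  move=> j _; apply: cvgM; first exact: cvg_cst.
  by apply: cvgB; [exact: cvg_cst|exact: cu].
apply: (cvgr_to_le c); exists (e i) => // m /= im.
have h : \sum_(j <- s) out i j * (1 - v m j) <= asum (fun j => out i j * (1 - v m j)).
  apply: (@sum_le_asum _ _ (fun j => out i j * (1 - v m j))) => //.
    apply: (@summ_jump_rate_bounded _ _ _ rateQ _ _ 1) => j.
    by have /andP[? ?] := exit_laplace_bnd m j; rewrite ger0_norm; lra.
  by move=> j; rewrite mulr_ge0// subr_ge0; have /andP[] := exit_laplace_bnd m j.
apply: (le_trans h).
rewrite (_ : (fun j => _) = fun j => out i j - out i j * v m j); last first.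
  by apply/funext => j; rewrite mulrBr mulr1.
rewrite asumB ?asum_jump_rate//; [|exact: summ_jump_rate|exact: summ_exit].
have := u_le m.+1 i; rewrite exit_laplaceS im ler_pdivlMr//; lra.
Qed.

(** The converse of the Lyapunov criterion for non-explosion. The functions v_m are
    1 outside finite sets, satisfy Q v <= v and decrease to 0. Along a subsequence
    on which they are summable at every site, their sum is finite, is at least k
    outside some finite set for each k, and inherits the inequality. *)
Theorem lyapunov_exists : exists V : F -> R,
  [/\ forall i, 0 <= V i, forall c, finite_set [set i | V i <= c] &
      forall i, abs_summable (fun j => out i j * V j) /\
                asum (fun j => out i j * V j) <= (1 - Q i i) * V i].
Proof.
(* The summable subsequence: its k-th term is at most 2^-k at the first k sites. *)
have small k : exists n, forall i, (e i < k)%N -> v n i <= 2^-1 ^+ k.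
  have e0 : 0 < 2^-1 ^+ k :> R by rewrite exprn_gt0.
  have fin : finite_set [set i | (e i < k)%N].
    by apply: (@finite_preimage _ _ `I_k e) => // x y _ _; exact: injective_e.
  have /finite_seqP[s sE] := fin.
  have : \forall n \near \oo, forall i, i \in s -> v n i <= 2^-1 ^+ k.
    apply: (@near_all_mem _ _ _ s (fun y n => v n y <= 2^-1 ^+ k)) => y.
    exact: (@cvgr_le _ _ _ _ _ _ (exit_laplace_cvg0 y)).
  case=> n _ /(_ n (leqnn n)) h; exists n => i ik; apply: h.
  by have : [set i | (e i < k)%N] i by []; rewrite sE.
have [n hn] := choice small.
pose S i K := \sum_(0 <= k < K) v (n k) i.
have v0 m i : 0 <= v m i by have /andP[] := exit_laplace_bnd m i.
have Snd i : nondecreasing_seq (S i).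
  by apply/nondecreasing_seqP => K; rewrite /S big_nat_recr//= ler_wpDr.
have geo K : \sum_(0 <= k < K) (2^-1 ^+ k : R) = 2 - 2 * 2^-1 ^+ K.
  by elim: K => [|K IH]; rewrite ?big_nil ?big_nat_recr//= ?IH ?expr0 ?exprS; lra.
have Sub i : has_ubound (range (S i)).
  exists ((e i).+1%:R + 2) => _ [K _ <-].
  have : S i K <= \sum_(0 <= k < K) ((k <= e i)%N%:R + 2^-1 ^+ k).
    apply: ler_sum_nat => k _; have [ki|ki] := leqP k (e i).
      rewrite (le_trans (proj2 (andP (exit_laplace_bnd (n k) i))))//.
      by rewrite lerDl exprn_ge0.
    by rewrite add0r; exact: hn.
  move=> /le_trans; apply; rewrite big_split/= geo.
  have count : \sum_(0 <= k < K) ((k <= e i)%N%:R : R) = (minn K (e i).+1)%:R.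
    elim: K => [|K IH]; first by rewrite big_nil min0n.
    rewrite big_nat_recr//= IH -natrD; congr (_%:R).
    by case: (leqP K (e i)) => /= h; lia.
  have : 0 <= 2^-1 ^+ K :> R by rewrite exprn_ge0.
  have : (minn K (e i).+1)%:R <= (e i).+1%:R :> R by rewrite ler_nat geq_minr.
  by rewrite count; lra.
pose V i := limn (S i).
have cV i : S i K @[K --> \oo] --> V i.
  by apply: nondecreasing_is_cvgn; [exact: Snd|exact: Sub].
have SV i K : S i K <= V i.
  by apply: nondecreasing_cvgn_le; [exact: Snd|exact: cV].
have V0 i : 0 <= V i by have := SV i 0%N; rewrite /S big_nil.
exists V; split=> // [c|i].
  pose m := (Num.truncn c).+1.
  (* A site numbered M or more has v = 1 in the first m terms of the series. *)
  pose M := \max_(k < m) n k.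
  have fin : finite_set [set i | (e i < M)%N].
    by apply: (@finite_preimage _ _ `I_M e) => // x y _ _; exact: injective_e.
  apply: sub_finite_set fin => i /= Vc; rewrite ltnNge; apply/negP => Mi.
  have : S i m = m%:R.
    rewrite /S big_mkord (eq_bigr (fun=> 1)) ?sumr_const ?card_ord// => k _.
    apply: exit_laplace_out; apply: leq_trans Mi; rewrite /M.
    exact: (leq_bigmax k).
  have := SV i m; have := truncnS_gt c; rewrite -/m; lra.
apply: summP => [j|s us]; first by rewrite mulr_ge0.
have c : \sum_(j <- s) out i j * S j K @[K --> \oo] --> \sum_(j <- s) out i j * V j.
  apply: cvg_big; first exact: add_continuous.
  by move=> j _; apply: cvgM; [exact: cvg_cst|exact: cV].
apply: (cvgr_to_le c); apply: nearW => K.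
have -> : \sum_(j <- s) out i j * S j K =
   \sum_(0 <= k < K) \sum_(j <- s) out i j * v (n k) j.
  by rewrite exchange_big/=; apply: eq_bigr => j _; rewrite mulr_sumr.
apply: (@le_trans _ _ ((1 - Q i i) * S i K)); last by rewrite ler_wpM2l// ltW.
rewrite /S mulr_sumr; apply: ler_sum => k _.
apply: le_trans (exit_laplace_super _ _).
apply: (@sum_le_asum _ _ (fun j => out i j * v (n k) j)) => //.
  exact: summ_exit.
by move=> j; rewrite mulr_ge0.
Qed.

End Lyapunov.

(** * Drift of one pair of particles *)

Section PairRates.
Context (R : realType) (F : pointedType) (Q : F -> F -> R).
Hypothesis rateQ : rate_matrix Q.
Implicit Types (i j : F).
Local Notation out := (jump_rate Q).
Let out_ge0 := jump_rate_ge0 rateQ.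
Let outs := summ_jump_rate rateQ.

(** The rates at which the two members of a pair at sites [i], [i'] arrive at the
    same site [j]: either one joins the other, or both jump to [j]. *)
Definition meeting_rate i i' j : R :=
  if j == i then out i' i else if j == i' then out i i'
  else Num.min (out i j) (out i' j).

Lemma meeting_rate_ge0 i i' j : 0 <= meeting_rate i i' j.
Proof.
rewrite /meeting_rate; case: ifP => // _; case: ifP => // _.
by rewrite le_min !out_ge0.
Qed.

Lemma summ_meeting_rate i i' : abs_summable (meeting_rate i i').
Proof.
apply: (@le_summ _ _ _ (fun j => out i j + out i' j)); last exact: summD.
move=> j; rewrite ger0_norm ?meeting_rate_ge0// /meeting_rate.
case: eqP => [->|_]; first by rewrite lerDr.
case: eqP => [->|_]; first by rewrite lerDl.
by apply: le_trans (_ : _ <= out i j) _; rewrite ?ge_min ?lexx// lerDl.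
Qed.

Section OnePair.
Context (i i' : F) (D D' : F -> R) (V : F -> R) (th ep r M : R).
Hypothesis D_le : forall j, `|D j| <= M.
Hypothesis D'_le : forall j, `|D' j| <= M.
Hypothesis th0 : 0 <= th.
Hypothesis ep0 : 0 <= ep.
Hypothesis Di : D i = 0.
Hypothesis D'i : D' i' = 0.
Hypothesis V_drift : forall i, abs_summable (fun j => out i j * V j) /\
  asum (fun j => out i j * V j) <= (1 - Q i i) * V i.
Hypothesis DD' : forall j j',
  D j - D' j' <= th * ((j != j')%:R - (i != i')%:R) + ep * (V j - V i + (V j' - V i')).

Lemma drift_le k : abs_summable (fun j => out k j * (V j - V k)) /\
  asum (fun j => out k j * (V j - V k)) <= V k.
Proof.
have [s h] := V_drift k.
have -> : (fun j => out k j * (V j - V k)) = (fun j => out k j * V j - V k * out k j).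
  by apply/funext => j; lra.
split; first by apply: summD => //; apply: summN; exact: summZ.
rewrite asumB//; last exact: summZ.
by rewrite asumZ// (asum_jump_rate rateQ); lra.
Qed.

(** The two particles jump simultaneously to [j] at rate min (Q i j, Q i' j), and
    the remaining rates are used by one particle while the other stays. Each
    configuration change is estimated by [DD'], and jumps in which the pair
    remains split contribute only through V. *)
Lemma pair_drift : (i != i' -> r <= asum (meeting_rate i i')) ->
  asum (fun j => out i j * D j) - asum (fun j => out i' j * D' j) <=
  - r * th * (i != i')%:R + ep * (V i + V i').
Proof.
move=> hr.
have [s1 h1] := drift_le i; have [s2 h2] := drift_le i'.
have sD := summ_jump_rate_bounded rateQ i D_le.
have sD' := summ_jump_rate_bounded rateQ i' D'_le.
pose w j := (i != i')%:R * meeting_rate i i' j.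
have sw : abs_summable w by apply: summZ; exact: summ_meeting_rate.
have : asum (fun j => out i j * D j) - asum (fun j => out i' j * D' j) <=
  asum (fun j => - th * w j + ep * (out i j * (V j - V i) + out i' j * (V j - V i'))).
  rewrite -asumB//; apply: le_asum.
  - by apply: summD => //; exact: summN.
  - by apply: summD; apply: summZ => //; exact: summD.
  - move=> j; have o1 := out_ge0 i j; have o2 := out_ge0 i' j.
    (* The inequality between the sums holds term by term, for each target site j. *)
    have oii k : out k k = 0 by rewrite /jump_rate eqxx.
    have [e|ne] := eqVneq i i'.
      rewrite /w e eqxx mul0r mulr0 add0r -e.
      have := DD' j j; rewrite !eqxx e eqxx -e subrr mulr0 add0r => h.
      by have := ler_wpM2l o1 h; lra.
    have t1 : (true%:R : R) = 1 by [].
    have t0 : ((~~ true)%:R : R) = 0 by [].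
    rewrite /w ne mul1r /meeting_rate.
    have dj := DD' j i'; have dj' := DD' i j; have djj := DD' j j.
    rewrite ne eqxx in dj dj' djj; rewrite Di in dj'; rewrite D'i in dj.
    have [ji|ji] := eqVneq j i.
      rewrite ji oii; rewrite ji eqxx in dj'.
      have o : 0 <= out i' i by [].
      by have := ler_wpM2l o dj'; rewrite t0 t1; lra.
    have [ji'|ji'] := eqVneq j i'.
      rewrite ji' oii; rewrite ji' eqxx in dj.
      have o : 0 <= out i i' by [].
      by have := ler_wpM2l o dj; rewrite t0 t1; lra.
    rewrite ji' in dj; rewrite eq_sym ji in dj'.
    (* Joint jump at rate m, then each particle alone at its excess rate. *)
    set m := Num.min _ _.
    have m0 : 0 <= m by rewrite le_min o1 o2.
    have m1 : 0 <= out i j - m by rewrite subr_ge0 ge_min lexx.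
    have m2 : 0 <= out i' j - m by rewrite subr_ge0 ge_min lexx orbT.
    have := ler_wpM2l m0 djj; have := ler_wpM2l m1 dj; have := ler_wpM2l m2 dj'.
    by rewrite /= t0 t1; lra.
move=> /le_trans; apply.
rewrite asumD; [|exact: summZ|by apply: summZ; exact: summD].
have aw : asum w = (i != i')%:R * asum (meeting_rate i i').
  by rewrite asumZ//; exact: summ_meeting_rate.
rewrite (asumZ _ sw) aw (asumZ _ (summD s1 s2)) (asumD s1 s2).
have := ler_wpM2l ep0 (lerD h1 h2).
case: (i != i') hr => [/(_ isT) h|_] /=; last by lra.
by have := ler_wpM2l th0 h; lra.
Qed.

End OnePair.
End PairRates.

Section Selection.
Context (R : realType) (F : pointedType) (N : nat) (p0 : F -> R) (pm pp : R).
Hypothesis p0_bnd : forall i, pm <= p0 i <= pp.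
Hypothesis pm0 : 0 <= pm.
Hypothesis N2 : (2 <= N)%N.
Context (x x' : 'I_N -> F) (D D' : 'I_N -> F -> R) (V : F -> R) (th ep : R).
Hypothesis V0 : forall i, 0 <= V i.
Hypothesis th0 : 0 <= th.
Hypothesis ep0 : 0 <= ep.
Hypothesis Dx : forall k, D k (x k) = 0.
Hypothesis D'x : forall k, D' k (x' k) = 0.
Hypothesis DD' : forall k j j', D k j - D' k j' <=
  th * ((j != j')%:R - (x k != x' k)%:R) + ep * (V j - V (x k) + (V j' - V (x' k))).

Local Notation dl k := ((x k != x' k)%:R : R).

Let m k := Num.min (p0 (x k)) (p0 (x' k)).

(** Both particles of pair k die at the smaller of the two death rates and copy
    pair l. The excess rate of one of them acts on it alone; it is positive only
    for a split pair, which can then not get worse. *)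
Lemma selection_pair k l :
  p0 (x k) * D k (x l) - p0 (x' k) * D' k (x' l) <=
  th * (m k * (dl l - dl k)) +
  ep * pp * (V (x l) + V (x' l)).
Proof.
have /andP[a1 a2] := p0_bnd (x k); have /andP[b1 b2] := p0_bnd (x' k).
have h : p0 (x k) * D k (x l) - p0 (x' k) * D' k (x' l) <=
  th * (m k * (dl l - dl k)) +
  ep * (p0 (x k) * (V (x l) - V (x k)) + p0 (x' k) * (V (x' l) - V (x' k))).
  have d1 := DD' k (x l) (x' l); have d2 := DD' k (x l) (x' k).
  have d3 := DD' k (x k) (x' l); rewrite D'x in d2; rewrite Dx in d3.
  have m0 : 0 <= m k by rewrite /m le_min !(le_trans pm0).
  have m1 : 0 <= p0 (x k) - m k by rewrite subr_ge0 ge_min lexx.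
  have m2 : 0 <= p0 (x' k) - m k by rewrite subr_ge0 ge_min lexx orbT.
  have [e|ne] := eqVneq (x k) (x' k).
    have mk : m k = p0 (x k) by rewrite /m e minxx.
    rewrite e eqxx in d1; rewrite mk e in m0 *.
    by have := ler_wpM2l m0 d1; lra.
  rewrite ne in d1 d2 d3.
  have c (b : bool) : th * (b%:R - true%:R) <= 0.
    by apply: mulr_ge0_le0 => //; case: b => /=; lra.
  have {}d2 : D k (x l) - 0 <= ep * (V (x l) - V (x k)).
    by apply: (le_trans d2); have := c (x l != x' k); lra.
  have {}d3 : 0 - D' k (x' l) <= ep * (V (x' l) - V (x' k)).
    by apply: (le_trans d3); have := c (x k != x' l); lra.
  have := ler_wpM2l m0 d1; have := ler_wpM2l m1 d2; have := ler_wpM2l m2 d3.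
  by lra.
apply: (le_trans h); rewrite lerD2l -mulrA ler_wpM2l// [leRHS]mulrDr.
have pV i j : p0 i * (V j - V i) <= pp * V j.
  have /andP[c1 c2] := p0_bnd i.
  have := mulr_ge0 (le_trans pm0 c1) (V0 i).
  by have := ler_wpM2r (V0 j) c2; lra.
by rewrite lerD.
Qed.

(** Subtracting [pm] from the rates does not change the sum, by antisymmetry. The
    remaining positive terms come from a split pair l and an unsplit pair k; for
    each l there are at most N - 1 of them. *)
Lemma swap_sum : \sum_k \sum_l m k * (dl l - dl k) <= (pp - pm) * (N.-1%:R * \sum_k dl k).
Proof.
have -> : \sum_k \sum_l m k * (dl l - dl k) = \sum_k \sum_l (m k - pm) * (dl l - dl k).
  have z : \sum_k \sum_l (dl l - dl k) = 0.
    rewrite (eq_bigr (fun k => \sum_l dl l - \sum_(l < N) dl k)); last first.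
      by move=> k _; rewrite sumrB.
    by rewrite sumrB exchange_big/= subrr.
  apply/eqP; rewrite -subr_eq0 -sumrB; apply/eqP.
  transitivity (pm * \sum_k \sum_l (dl l - dl k)); last by rewrite z mulr0.
  rewrite mulr_sumr; apply: eq_bigr => k _.
  by rewrite mulr_sumr -sumrB; apply: eq_bigr => l _; lra.
have pd0 : 0 <= pp - pm.
  by rewrite subr_ge0; have /andP[+ /(le_trans _)] := p0_bnd point; move=> h; apply.
apply: (@le_trans _ _ (\sum_k \sum_l (pp - pm) * (dl l * (1 - dl k)))).
  apply: ler_sum => k _; apply: ler_sum => l _.
  have /andP[a1 a2] := p0_bnd (x k); have /andP[b1 b2] := p0_bnd (x' k).
  have c1 : 0 <= m k - pm by rewrite subr_ge0 /m le_min a1 b1.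
  have c2 : m k - pm <= pp - pm by rewrite lerD2r /m ge_min a2.
  by case: (x l != x' l); case: (x k != x' k) => /=; lra.
rewrite exchange_big/= mulrA mulr_sumr; apply: ler_sum => l _.
rewrite (bigD1 l)//= [X in X + _](_ : _ = 0); last by case: (x l != x' l) => /=; lra.
rewrite add0r.
apply: (@le_trans _ _ (\sum_(k < N | k != l) (pp - pm) * dl l)).
  apply: ler_sum => k _; rewrite ler_wpM2l//.
  by case: (x l != x' l); case: (x k != x' k) => /=; lra.
rewrite sumr_const -mulr_natr.
have -> : #|[pred k : 'I_N | k != l]| = N.-1.
  by have := cardC1 l; rewrite card_ord.
by lra.
Qed.

Lemma selection_drift :
  \sum_k p0 (x k) / N.-1%:R * \sum_l D k (x l) -
  \sum_k p0 (x' k) / N.-1%:R * \sum_l D' k (x' l) <=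
  th * (pp - pm) * \sum_k dl k +
  ep * (2 * pp) * (\sum_k V (x k) + \sum_k V (x' k)).
Proof.
have n0 : 0 < N.-1%:R :> R by rewrite ltr0n; case: N N2 => [|[]].
have pp0 : 0 <= pp by have /andP[a b] := p0_bnd point; exact: le_trans pm0 (le_trans a b).
have W0 y : 0 <= \sum_(k < N) V (y k) by apply: sumr_ge0.
rewrite -sumrB.
have -> : \sum_(k < N) (p0 (x k) / N.-1%:R * \sum_l D k (x l) -
     p0 (x' k) / N.-1%:R * \sum_l D' k (x' l)) =
   N.-1%:R^-1 * \sum_(k < N) \sum_l (p0 (x k) * D k (x l) - p0 (x' k) * D' k (x' l)).
  rewrite mulr_sumr; apply: eq_bigr => k _; rewrite sumrB -!mulr_sumr.
  by lra.
rewrite ler_pdivrMl//.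
apply: (@le_trans _ _ (\sum_(k < N) \sum_l (th * (m k * (dl l - dl k)) +
     ep * pp * (V (x l) + V (x' l))))).
  by apply: ler_sum => k _; apply: ler_sum => l _; exact: selection_pair.
set W := \sum_k V (x k) + \sum_k V (x' k).
rewrite (eq_bigr (fun k => th * (\sum_l m k * (dl l - dl k)) + ep * pp * W)); last first.
  move=> k _; rewrite big_split/=; congr (_ + _); first by rewrite mulr_sumr.
  by rewrite -mulr_sumr big_split.
rewrite big_split/= -mulr_sumr sumr_const card_ord -[X in _ + X <= _]mulr_natr.
have := ler_wpM2l th0 swap_sum.
have NN : N%:R <= 2 * N.-1%:R :> R.
  by rewrite -natrM ler_nat; lia.
have W1 : 0 <= ep * pp * W by rewrite !mulr_ge0// addr_ge0.
have := ler_wpM2r W1 NN.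
by lra.
Qed.

End Selection.

(** * Configurations as labelled particles *)

Section Labels.
Context (R : realType) (F : pointedType) (N : nat).
Local Notation E := (configuration F N).
Implicit Types (eta xi : E) (x : 'I_N -> F) (V : F -> R).

(** A configuration is handled through a choice of positions for N numbered
    particles, which turns the sums over sites into sums over particles. *)
Definition labels x eta := forall i, eta i = (\sum_(k < N) (x k == i))%N.

Definition relabel x (k : 'I_N) (j : F) : 'I_N -> F := fun l => if l == k then j else x l.

Lemma labels_occupied x eta k : labels x eta -> eta (x k) != 0%N.
Proof. by move=> h; rewrite h (bigD1 k)//= eqxx. Qed.

Lemma labels_move x eta k j : labels x eta ->
  labels (relabel x k j) (move (x k) j eta).
Proof.
move=> h i; rewrite moveE; last exact: labels_occupied.
have e : (\sum_(l < N | l != k) (relabel x k j l == i) = \sum_(l < N | l != k) (x l == i))%N.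
  by apply: eq_bigr => l /negPf lk; rewrite /relabel lk.
rewrite /move_fun h (bigD1 k)//= [RHS](bigD1 k)//= e {1}/relabel eqxx.
rewrite [i == x k]eq_sym [i == j]eq_sym; set s := (\sum_(_ < _ | _) _)%N.
by case: (x k == i); case: (j == i) => /=; lia.
Qed.

Lemma labels_inj x eta xi : labels x eta -> labels x xi -> eta = xi.
Proof.
move=> h h'; apply: val_inj; apply/funext => i /=.
by rewrite [LHS]h [RHS]h'.
Qed.

Lemma move_id i eta : eta i != 0%N -> move i i eta = eta.
Proof.
move=> ei; apply: val_inj; apply: etrans (moveE i ei) _; apply/funext => k /=.
rewrite /move_fun; case: eqVneq => [->|_]; last by rewrite subn0 addn0.
by rewrite subnK// lt0n.
Qed.

Let supp_fset x := [fset y in [seq x k | k <- enum 'I_N]]%fset.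

Let x_supp x k : x k \in supp_fset x.
Proof. by rewrite !inE; apply/mapP; exists k => //; rewrite mem_enum. Qed.

Let out_supp x j : j \notin supp_fset x -> forall k, (x k == j) = false.
Proof.
by move=> jx k; apply: contraNF jx => /eqP <-; exact: x_supp.
Qed.

Lemma sum_labels x eta (phi : F -> R) : labels x eta ->
  \sum_(i \in [set: F]) (eta i)%:R * phi i = \sum_k phi (x k).
Proof.
move=> h; rewrite (fsbigTE (supp_fset x)); last first.
  move=> j jx; rewrite h big1 ?mul0r// => k _.
  by rewrite (out_supp jx).
under eq_bigr do rewrite h natr_sum mulr_suml.
rewrite exchange_big/=; apply: eq_bigr => k _.
rewrite (bigD1_seq (x k)) ?fset_uniq ?x_supp//= eqxx mul1r big1 ?addr0//.
by move=> j /negPf; rewrite eq_sym => ->; rewrite mul0r.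
Qed.

(** Each index contributes to at most two of the terms of d1, and to none when the
    two labels agree. *)
Lemma d1_labels x x' eta xi : labels x eta -> labels x' xi ->
  d1 R eta xi <= \sum_(k < N) (x k != x' k)%:R.
Proof.
move=> h h'; rewrite /d1 ler_pdivrMl//.
rewrite (fsbigTE (supp_fset x `|` supp_fset x')%fset); last first.
  move=> j; rewrite inE negb_or => /andP[jx jx'].
  rewrite h h' !big1 ?subrr ?normr0// => k _; first by rewrite (out_supp jx').
  by rewrite (out_supp jx).
apply: (@le_trans _ _ (\sum_(j <- (supp_fset x `|` supp_fset x')%fset)
   \sum_(k < N) `|(x k == j)%:R - (x' k == j)%:R : R|)).
  by apply: ler_sum => j _; rewrite h h' !natr_sum -sumrB; exact: ler_norm_sum.
rewrite exchange_big/= mulr_sumr; apply: ler_sum => k _.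
apply: (@le_trans _ _ (\sum_(j <- (supp_fset x `|` supp_fset x')%fset)
   (x k != x' k)%:R * ((x k == j)%:R + (x' k == j)%:R))).
  apply: ler_sum => j _; case: (eqVneq (x k) (x' k)) => [->|ne].
    by rewrite subrr normr0 mul0r.
  rewrite mul1r; case: eqVneq => [<-|_]; last by rewrite sub0r normrN add0r ger0_norm.
  by rewrite eq_sym (negPf ne) subr0 addr0 normr1.
rewrite -mulr_sumr mulrC ler_wpM2r// big_split/=.
have one (y : F) : \sum_(j <- (supp_fset x `|` supp_fset x')%fset) ((y == j)%:R : R) <= 1.
  have [yi|yn] := boolP (y \in (supp_fset x `|` supp_fset x')%fset).
    rewrite (bigD1_seq y) ?fset_uniq//= eqxx big1 ?addr0// => j /negPf.
    by rewrite eq_sym => ->.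
  rewrite big_seq big1// => j ji; case: eqP => // yj.
  by move: yn; rewrite yj ji.
by have := lerD (one (x k)) (one (x' k)); lra.
Qed.

Section FromMultiplicities.
Variable B : seq F.
Hypothesis uB : uniq B.

Let mk (f : F -> nat) : seq F := flatten [seq nseq (f i) i | i <- B].

Let count_mk f i : (forall j, j \notin B -> f j = 0%N) -> count_mem i (mk f) = f i.
Proof.
move=> fB; rewrite /mk count_flatten -map_comp sumnE big_map.
have [iB|iB] := boolP (i \in B).
  rewrite (bigD1_seq i)//= count_nseq /= eqxx mul1n big1 ?addn0// => j /negPf ji.
  by rewrite count_nseq /= ji.
rewrite fB// big_seq big1// => j jB; rewrite /= count_nseq /=.
by case: eqVneq => // ji; rewrite -ji jB in iB.
Qed.

Let size_mk f : size (mk f) = (\sum_(i <- B) f i)%N.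
Proof.
rewrite /mk size_flatten /shape -map_comp sumnE big_map; apply: eq_bigr => i _.
by rewrite /= size_nseq.
Qed.

Let labels_seq (s : seq F) eta : size s = N -> (forall i, count_mem i s = eta i) ->
  labels (fun k => nth point s k) eta.
Proof.
move=> ss cs i; rewrite -cs -sum1_count (big_nth point) ss big_mkord [LHS]big_mkcond/=.
by apply: eq_bigr => k _; case: eqP.
Qed.

(** Give the same labels to the particles that the two configurations have in
    common at each site; the others are as many as d1. *)
Lemma optimal_labels_supp eta xi :
  (forall j, j \notin B -> eta j = 0%N) -> (forall j, j \notin B -> xi j = 0%N) ->
  (\sum_(i <- B) eta i)%N = N -> (\sum_(i <- B) xi i)%N = N ->
  exists x x', [/\ labels x eta, labels x' xi &
    d1 R eta xi = \sum_(k < N) (x k != x' k)%:R].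
Proof.
move=> eB xB eN xN.
pose c i := minn (eta i) (xi i); pose r i := (eta i - c i)%N; pose r' i := (xi i - c i)%N.
have cB j : j \notin B -> c j = 0%N by move=> /eB e; rewrite /c e min0n.
have rB j : j \notin B -> r j = 0%N by move=> /eB e; rewrite /r e sub0n.
have r'B j : j \notin B -> r' j = 0%N by move=> /xB e; rewrite /r' e sub0n.
have cr i : (c i + r i = eta i)%N by rewrite /r subnKC// geq_minl.
have cr' i : (c i + r' i = xi i)%N by rewrite /r' subnKC// geq_minr.
pose s := mk c ++ mk r; pose s' := mk c ++ mk r'.
have ss : size s = N.
  by rewrite size_cat !size_mk -big_split -eN; apply: eq_bigr => i _; exact: cr.
have ss' : size s' = N.
  by rewrite size_cat !size_mk -big_split -xN; apply: eq_bigr => i _; exact: cr'.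
have lx : labels (fun k => nth point s k) eta.
  by apply: labels_seq => // i; rewrite count_cat !count_mk.
have lx' : labels (fun k => nth point s' k) xi.
  by apply: labels_seq => // i; rewrite count_cat !count_mk.
exists (fun k => nth point s k), (fun k => nth point s' k); split=> //.
apply/le_anti/andP; split; first exact: d1_labels.
have rr' : (\sum_(i <- B) r i = \sum_(i <- B) r' i)%N.
  by move: ss ss'; rewrite !size_cat !size_mk; lia.
have d1E : d1 R eta xi = (\sum_(i <- B) r i)%N%:R.
  rewrite /d1 (fsbigTE [fset y in B]%fset); last first.
    by move=> j; rewrite !inE => jB; rewrite eB// xB// subrr normr0.
  rewrite (perm_big B)/=; last first.
    by apply: uniq_perm => //; [exact: fset_uniq|move=> j; rewrite !inE].
  rewrite (eq_bigr (fun i => (r i)%:R + (r' i)%:R)); last first.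
    move=> i _; rewrite /r /r' /c.
    have [h|h] := leqP (eta i) (xi i).
      by rewrite subnn natrB// add0r ler0_norm ?opprB// subr_le0 ler_nat.
    by rewrite subnn natrB 1?ltnW// addr0 ger0_norm// subr_ge0 ler_nat ltnW.
  by rewrite big_split/= -!natr_sum -rr'; lra.
rewrite d1E -natr_sum ler_nat -size_mk.
apply: (@leq_trans (\sum_(k < N) (size (mk c) <= k))%N).
  apply: leq_sum => k _; rewrite !nth_cat; case: ltnP => //= _; first by rewrite eqxx.
  by case: (_ != _).
have -> : size (mk r) = (N - size (mk c))%N by rewrite -ss size_cat addKn.
move: (size (mk c)) => a; elim: (N) => [|n IH]; first by rewrite big_ord0.
by rewrite big_ord_recr/=; move: IH; case: leqP => /=; lia.
Qed.

End FromMultiplicities.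

Lemma optimal_labels eta xi :
  exists x x', [/\ labels x eta, labels x' xi &
    d1 R eta xi = \sum_(k < N) (x k != x' k)%:R].
Proof.
have /asboolP[fe se] := configurationP eta; have /asboolP[fx sx] := configurationP xi.
have /finite_seqP[s1 s1E] := fe; have /finite_seqP[s2 s2E] := fx.
pose B := undup (s1 ++ s2).
have eB j : j \notin B -> eta j = 0%N.
  rewrite mem_undup mem_cat negb_or => /andP[js _]; apply/eqP; apply: contraNT js => h.
  by have : [set i | eta i != 0%N] j by []; rewrite s1E.
have xB j : j \notin B -> xi j = 0%N.
  rewrite mem_undup mem_cat negb_or => /andP[_ js]; apply/eqP; apply: contraNT js => h.
  by have : [set i | xi i != 0%N] j by []; rewrite s2E.
have toB (f : F -> nat) : (forall j, j \notin B -> f j = 0%N) ->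
    \sum_(i \in [set: F]) f i = (\sum_(i <- B) f i)%N.
  move=> fB; rewrite (fsbigTE [fset y in B]%fset); last first.
    by move=> j; rewrite !inE => /fB.
  apply: perm_big; apply: uniq_perm; [exact: fset_uniq|exact: undup_uniq|].
  by move=> j; rewrite !inE.
apply: (optimal_labels_supp (undup_uniq _) eB xB); first by rewrite -toB.
by rewrite -toB.
Qed.

Lemma labels_exist eta : exists x, labels x eta.
Proof. by have [x [_ [h _ _]]] := optimal_labels eta eta; exists x. Qed.

Definition moment V eta : R := \sum_(i \in [set: F]) (eta i)%:R * V i.

Lemma momentE V x eta : labels x eta -> moment V eta = \sum_k V (x k).
Proof. exact: sum_labels. Qed.

Lemma d1_ge0 eta xi : 0 <= d1 R eta xi.
Proof.
by have [x [x' [_ _ ->]]] := optimal_labels eta xi; apply: sumr_ge0.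
Qed.

Lemma d1_le_N eta xi : d1 R eta xi <= N%:R.
Proof.
have [x [x' [_ _ ->]]] := optimal_labels eta xi.
apply: (@le_trans _ _ (\sum_(k < N) 1)); last by rewrite sumr_const card_ord.
by apply: ler_sum => k _; case: (_ != _).
Qed.

Lemma d1_ge1 eta xi : eta != xi -> 1 <= d1 R eta xi.
Proof.
have [x [x' [h h' ->]]] := optimal_labels eta xi => ne.
have [k xk] : exists k, x k != x' k.
  apply: contrapT => nk; move/eqP: ne; apply.
  apply: (labels_inj h); have -> // : x = x'.
  by apply/funext => k; apply/eqP; apply: contrapT => /negP kk; apply: nk; exists k.
by rewrite (bigD1 k)//= xk lerDl; apply: sumr_ge0.
Qed.

Lemma moment_ge0 V eta : (forall i, 0 <= V i) -> 0 <= moment V eta.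
Proof.
by move=> V0; have [x h] := labels_exist eta; rewrite (momentE _ h) sumr_ge0.
Qed.

End Labels.

(** * The coupling inequality *)

Section Coupling.
Context (R : realType) (F : pointedType) (N : nat) (Q : F -> F -> R) (p0 : F -> R).
Hypothesis rateQ : rate_matrix Q.
Hypothesis N2 : (2 <= N)%N.
Local Notation E := (configuration F N).
Local Notation out := (jump_rate Q).
Implicit Types (eta xi : E) (u : E -> R) (x : 'I_N -> F).

Definition jump_diff u eta i j := u (move i j eta) - u eta.

Lemma jump_diff_bnd u eta i M : (forall xi, `|u xi| <= M) ->
  forall j, `|jump_diff u eta i j| <= M + M.
Proof. by move=> uM j; apply: le_trans (ler_normB _ _) _; exact: lerD. Qed.

(** In terms of labels the death part of the generator reads: a particle at rate
    [p0] takes the position of another one chosen uniformly. The choice of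
    itself has no effect, so the sum may run over all l. *)
Lemma generator_labels u eta x : bnd u -> labels x eta ->
  FV_generator Q p0 u eta =
  \sum_k asum (fun j => out (x k) j * jump_diff u eta (x k) j) +
  \sum_k p0 (x k) / N.-1%:R * \sum_l jump_diff u eta (x k) (x l).
Proof.
move=> [M uM] h; rewrite /FV_generator (sum_labels _ h) -big_split/=.
apply: eq_bigr => k _.
have b := jump_diff_bnd eta (x k) uM.
have Dx : jump_diff u eta (x k) (x k) = 0.
  by rewrite /jump_diff move_id ?subrr//; exact: labels_occupied h.
pose c l := p0 (x k) / N.-1%:R * jump_diff u eta (x k) (x l).
have -> : (fun j => (u (move (x k) j eta) - u eta) *
     (Q (x k) j + p0 (x k) * ((eta j)%:R / N.-1%:R))) =
   (fun j => out (x k) j * jump_diff u eta (x k) j +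
     \sum_(l <- index_enum 'I_N) c l * (j == x l)%:R).
  apply/funext => j; rewrite -/(jump_diff u eta (x k) j) h natr_sum mulrDr; congr (_ + _).
    by rewrite /jump_rate; case: eqVneq => [->|_]; rewrite ?Dx ?mulr0 ?mul0r// mulrC.
  rewrite mulr_suml !mulr_sumr; apply: eq_bigr => l _; rewrite /c.
  by rewrite eq_sym; case: eqVneq => [->|_] /=; lra.
have [s2 a2] := @asum_bigsum R F 'I_N (index_enum 'I_N) (fun l j => c l * (j == x l)%:R)
   (fun l => proj1 (delta_summ (x l) (c l))).
rewrite asumD//; last exact: (summ_jump_rate_bounded rateQ (x k) b).
congr (_ + _); rewrite a2 mulr_sumr; apply: eq_bigr => l _.
by have [] := delta_summ (x l) (c l).
Qed.

Context (pm pp r : R).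
Hypothesis p0_bnd : forall i, pm <= p0 i <= pp.
Hypothesis pm0 : 0 <= pm.
Hypothesis r_le : forall i i', i != i' -> r + (pp - pm) <= asum (meeting_rate Q i i').
Context (V : F -> R).
Hypothesis V0 : forall i, 0 <= V i.
Hypothesis V_drift : forall i, abs_summable (fun j => out i j * V j) /\
  asum (fun j => out i j * V j) <= (1 - Q i i) * V i.

Local Notation W := (moment V).

(** At the contact point (eta, eta'), the difference of the increments of u and u'
    along any simultaneous move of one pair is at most the increment of the
    right-hand side of the hypothesis. This feeds the drift estimates for the
    jumps and for the deaths; the meeting rates are at least r + (pp - pm), and deaths
    lose pp - pm. *)
Lemma coupling_inequality u u' (th ep : R) eta eta' :
  bnd u -> bnd u' -> 0 <= th -> 0 <= ep ->
  (forall xi xi', u xi - u' xi' <= th * d1 R xi xi' + ep * (1 + W xi + W xi')) ->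
  u eta - u' eta' = th * d1 R eta eta' + ep * (1 + W eta + W eta') ->
  FV_generator Q p0 u eta - FV_generator Q p0 u' eta' <=
  - r * th * d1 R eta eta' + ep * (1 + 2 * pp) * (W eta + W eta').
Proof.
move=> bu bu' th0 ep0 uu' uu'_eq.
have [x [x' [h h' dE]]] := optimal_labels R eta eta'.
rewrite (generator_labels bu h) (generator_labels bu' h').
have [M uM] := bu; have [M' uM'] := bu'.
pose dl k : R := (x k != x' k)%:R.
have DD k j j' : jump_diff u eta (x k) j - jump_diff u' eta' (x' k) j' <=
    th * ((j != j')%:R - dl k) + ep * (V j - V (x k) + (V j' - V (x' k))).
  have h1 := labels_move k j h; have h1' := labels_move k j' h'.
  have := uu' (move (x k) j eta) (move (x' k) j' eta').
  have d1m : d1 R (move (x k) j eta) (move (x' k) j' eta') <=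
     d1 R eta eta' + ((j != j')%:R - dl k).
    apply: (le_trans (d1_labels R h1 h1')); rewrite dE (bigD1 k)//= [X in _ <= X + _](bigD1 k)//=.
    rewrite /relabel eqxx -/(dl k).
    rewrite (eq_bigr (fun l => (x l != x' l)%:R)); last by move=> l /negPf ->.
    by lra.
  have Wm y xi i : labels y xi -> W (move (y k) i xi) = W xi - V (y k) + V i.
    move=> hy; rewrite (momentE _ (labels_move k i hy)) (momentE _ hy).
    rewrite (bigD1 k)//= [in RHS](bigD1 k)//= /relabel eqxx.
    rewrite (eq_bigr (fun l => V (y l))); last by move=> l /negPf ->.
    by lra.
  rewrite (Wm _ _ _ h) (Wm _ _ _ h') /jump_diff => hm.
  have := ler_wpM2l th0 d1m; lra.
have pp0 : 0 <= pp by have /andP[a b] := p0_bnd point; exact: le_trans pm0 (le_trans a b).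
have Dx k : jump_diff u eta (x k) (x k) = 0.
  by rewrite /jump_diff move_id ?subrr//; exact: labels_occupied h.
have Dx' k : jump_diff u' eta' (x' k) (x' k) = 0.
  by rewrite /jump_diff move_id ?subrr//; exact: labels_occupied h'.
have motion : \sum_k asum (fun j => out (x k) j * jump_diff u eta (x k) j) -
    \sum_k asum (fun j => out (x' k) j * jump_diff u' eta' (x' k) j) <=
    - (r + (pp - pm)) * th * d1 R eta eta' + ep * (W eta + W eta').
  rewrite -sumrB (momentE _ h) (momentE _ h') -big_split/= dE !mulr_sumr -big_split/=.
  apply: ler_sum => k _.
  apply: (@pair_drift R F Q rateQ (x k) (x' k) _ _ V th ep (r + (pp - pm)) (M + M + (M' + M'))).
  - move=> j; apply: le_trans (jump_diff_bnd eta (x k) uM j) _.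
    by rewrite lerDl addr_ge0// (le_trans _ (uM' eta)).
  - move=> j; apply: le_trans (jump_diff_bnd eta' (x' k) uM' j) _.
    by rewrite lerDr addr_ge0// (le_trans _ (uM eta)).
  - exact: th0.
  - exact: ep0.
  - exact: Dx.
  - exact: Dx'.
  - exact: V_drift.
  - exact: DD.
  - exact: r_le.
have := @selection_drift R F N p0 pm pp p0_bnd pm0 N2 x x'
  (fun k => jump_diff u eta (x k)) (fun k => jump_diff u' eta' (x' k)) V th ep V0 th0 ep0 Dx Dx' DD.
rewrite -dE -(momentE _ h) -(momentE _ h'); lra.
Qed.

End Coupling.

(** * Transition functions and their right derivatives *)

(** At the infimum of the times where P fails, P holds by the first hypothesis,
    and by the second one P holds a little longer. *)
Lemma real_induction (R : realType) (P : R -> Prop) :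
  (forall t, 0 <= t -> (forall s, 0 <= s < t -> P s) -> P t) ->
  (forall t, 0 <= t -> P t -> \forall h \near 0^'+, P (t + h)) ->
  forall t, 0 <= t -> P t.
Proof.
move=> closed right t0 t00; apply: contrapT => nP.
pose B := [set t | 0 <= t /\ ~ P t].
have Bt : B t0 by [].
have lB : has_lbound B by exists 0 => t [].
have b0 : 0 <= inf B by apply: lb_le_inf; [exists t0|move=> t []].
have Pb : P (inf B).
  apply: closed => // s /andP[s0 sb]; apply: contrapT => nPs.
  by have : inf B <= s by [apply: ge_inf]; lra.
have /= := right _ b0 Pb; rewrite near_withinE => -[d /= d0 hd].
have [s [[s0 nPs] sb]] : exists s, B s /\ s < inf B + d.
  apply: contrapT => nex; suff : inf B + d <= inf B by lra.
  apply: lb_le_inf; first by exists t0.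
  by move=> s Bs; rewrite leNgt; apply/negP => sd; apply: nex; exists s.
have bs : inf B <= s by apply: ge_inf.
have [e|ne] := eqVneq s (inf B); first by apply: nPs; rewrite e.
apply: nPs; rewrite -(subrKC (inf B) s).
have sbp : 0 < s - inf B by rewrite subr_gt0 lt_neqAle eq_sym ne.
apply: hd => //=; rewrite /ball_ /= sub0r normrN ger0_norm; lra.
Qed.

Section RightDerivatives.
Context (R : realType).
Implicit Types (f : R -> R).

Lemma expR_right_derivative (a t : R) :
  (expR (a * (t + h)) - expR (a * t)) / h @[h --> 0^'+] --> a * expR (a * t).
Proof.
have d : is_derive t 1 (fun s => expR (a * s)) (a * expR (a * t)).
  by apply: is_derive_eq; rewrite /GRing.scale/=; lra.
have [dd de] := d.
rewrite -de /derive; have := cvg_dnbhs_at_right dd.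
under eq_fun do rewrite /= /GRing.scale/= mulr1 mulrC [_ + t]addrC.
exact.
Qed.


Lemma right_nonpos f (l : R) : f 0 <= 0 ->
  (f h - f 0) / h @[h --> 0^'+] --> l -> (f 0 = 0 -> l < 0) ->
  \forall h \near 0^'+, f h <= 0.
Proof.
move=> f0 fl l0; have [e|ne] := eqVneq (f 0) 0.
  have /l0 l_lt0 := e.
  have : \forall h \near 0^'+, (f h - f 0) / h <= 0.
    by apply: (@cvgr_le _ _ _ _ _ _ fl).
  move=> h1; near=> h.
  have hp : 0 < h by near: h; exact: nbhs_right_gt.
  have : (f h - f 0) / h <= 0 by near: h; exact: h1.
  by rewrite e subr0 pmulr_lle0// invr_gt0.
have f0' : f 0 < 0 by rewrite lt_neqAle ne.
have : f 0 + h * ((f h - f 0) / h) @[h --> 0^'+] --> f 0 + 0 * l.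
  apply: cvgD; first exact: cvg_cst.
  apply: cvgM => //; apply: cvg_at_right_filter; exact: cvg_id.
rewrite mul0r addr0 => c.
have c' : \forall h \near 0^'+, f 0 + h * ((f h - f 0) / h) <= 0.
  by apply: (@cvgr_le _ _ _ _ _ _ c).
near=> h; have hp : 0 < h by near: h; exact: nbhs_right_gt.
have : f 0 + h * ((f h - f 0) / h) <= 0 by near: h; exact: c'.
by rewrite mulrC divfK ?gt_eqF// subrKC.
Unshelve. all: by end_near. Qed.

End RightDerivatives.

Section Mixtures.
Context (R : realType) (F : pointedType) (N : nat).
Local Notation E := (configuration F N).
Implicit Types (f g : E -> R) (mu nu : probability E R).
Local Notation mean m f := (\int[m]_x f x)%R.

Lemma measurable_configuration (A : set E) : measurable A.
Proof. by []. Qed.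
Local Notation mE := measurable_configuration.

Lemma mean_norm mu f M : (forall x, `|f x| <= M) -> `|mean mu f| <= M.
Proof. exact: (mf_norm (mf_mean mE mu)). Qed.

Lemma mf_mixture mu (k : E -> probability E R) :
  mean_functional (fun f => mean mu (fun x => mean (k x) f)).
Proof.
have hm := mf_mean mE mu; have hk x := mf_mean mE (k x).
have bk f : bnd f -> bnd (fun x => mean (k x) f).
  by move=> [M fM]; exists M => x; exact: mean_norm.
split.
- move=> f g bf bg.
  by rewrite -(mfD hm (bk _ bf) (bk _ bg)); apply: eq_Rintegral => x _; rewrite (mfD (hk x)).
- move=> a f bf.
  by rewrite -(mfZ hm _ (bk _ bf)); apply: eq_Rintegral => x _; rewrite (mfZ (hk x)).
- move=> f g bf bg fg; apply: (mf_le hm (bk _ bf) (bk _ bg)) => x.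
  exact: (mf_le (hk x)).
- rewrite -[RHS](mf1 hm); apply: eq_Rintegral => x _; exact: (mf1 (hk x)).
Qed.

Lemma mixture_mean mu nu (k : E -> probability E R) f :
  (forall A : set E, nu A = (\int[mu]_x k x A)%E) -> bnd f ->
  mean nu f = mean mu (fun x => mean (k x) f).
Proof.
move=> h; apply: (mf_ext (mf_mean mE nu) (mf_mixture mu k)) => A.
rewrite (mean_indic mE) h; congr fine; apply: eq_integral => x _.
by rewrite (mean_indic mE) fineK// fin_num_measure.
Qed.

Lemma mean_dirac mu eta f : (forall A : set E, mu A = \d_eta A) -> bnd f -> mean mu f = f eta.
Proof.
move=> h bf.
have he : mean_functional (fun f : E -> R => f eta).
  by split => // *.
apply: (mf_ext (mf_mean mE mu) he) => // A.
by rewrite (mean_indic mE) h diracE.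
Qed.

(** The two values differ only on the event of having left [eta]; the bound depends
    on f only through its supremum. *)
Lemma mean_away mu eta f M : (forall x, `|f x| <= M) ->
  `|mean mu f - f eta| <= 2 * M * (1 - mean mu \1_[set eta]).
Proof.
move=> fM; have hm := mf_mean mE mu.
have bf : bnd f by exists M.
have bi : bnd (\1_[set eta] : E -> R) by exact: bnd_indic.
have M0 : 0 <= M by apply: le_trans (fM eta).
have -> : 2 * M * (1 - mean mu \1_[set eta]) =
    mean mu (fun x => 2 * M * (1 - \1_[set eta] x)).
  rewrite (mfZ hm); last by apply: bndB => //; exact: bnd_cst.
  rewrite (mfB hm) ?(mf_cst 1 hm)//; exact: bnd_cst.
have -> : mean mu f - f eta = mean mu (fun x => f x - f eta).
  by rewrite (mfB hm)// ?(mf_cst _ hm)//; exact: bnd_cst.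
have bg : bnd (fun x => f x - f eta) by apply: bndB => //; exact: bnd_cst.
have bh : bnd (fun x => 2 * M * (1 - \1_[set eta] x : R)).
  by apply: bndZ; apply: bndB => //; exact: bnd_cst.
have pw x : `|f x - f eta| <= 2 * M * (1 - \1_[set eta] x).
  rewrite indicE; case: (pselect (x = eta)) => [->|ne].
    by rewrite subrr normr0 mem_set//= subrr mulr0.
  rewrite memNset//= subr0 mulr1; apply: le_trans (ler_normB _ _) _.
  by have := fM x; have := fM eta; lra.
rewrite ler_norml -(mfN hm)//; apply/andP; split; apply: (mf_le hm) => //.
- exact: bndN.
- by move=> x; have := pw x; rewrite ler_norml => /andP[].
- by move=> x; have := pw x; rewrite ler_norml => /andP[].
Qed.

Section Semigroup.
Context (L : (E -> R) -> E -> R) (Pt : R -> E -> probability E R).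
Hypothesis tPt : transition_function L Pt.

Definition semigroup t f eta := mean (Pt t eta) f.

Lemma semigroup_norm f M t eta : (forall x, `|f x| <= M) -> `|semigroup t f eta| <= M.
Proof. exact: mean_norm. Qed.

Lemma semigroup_bnd f t : bnd f -> bnd (semigroup t f).
Proof. by move=> [M fM]; exists M => eta; exact: semigroup_norm. Qed.

Lemma semigroup0 f eta : bnd f -> semigroup 0 f eta = f eta.
Proof. by move=> bf; apply: mean_dirac => // A; have [-> _ _] := tPt. Qed.

Lemma semigroupD f s t eta : bnd f -> 0 <= s -> 0 <= t ->
  semigroup (s + t) f eta = semigroup s (semigroup t f) eta.
Proof.
by move=> bf s0 t0; apply: mixture_mean => // A; have [_ h _] := tPt; exact: h.
Qed.

(** The generator is applied to [semigroup t f], which is bounded: this is the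
    backward equation. *)
Lemma semigroup_right_derivative f t eta : bnd f -> 0 <= t ->
  (semigroup (t + h) f eta - semigroup t f eta) / h @[h --> 0^'+] -->
  L (semigroup t f) eta.
Proof.
move=> bf t0; have [_ _ h3] := tPt.
apply: cvg_trans (h3 _ eta (bnd_bounded (semigroup_bnd t bf))).
apply: near_eq_cvg; near=> h.
have hp : 0 < h by near: h; exact: nbhs_right_gt.
by rewrite [t + h]addrC semigroupD// ltW.
Unshelve. all: by end_near. Qed.

Lemma stay_cvg1 eta : semigroup h \1_[set eta] eta @[h --> 0^'+] --> (1 : R).
Proof.
have bi : bnd (\1_[set eta] : E -> R) by exact: bnd_indic.
have i1 : \1_[set eta] eta = 1 :> R by rewrite indicE mem_set.
have := @semigroup_right_derivative _ 0 eta bi (lexx 0); rewrite semigroup0// i1 => c.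
have : 1 + h * ((semigroup (0 + h) \1_[set eta] eta - 1) / h) @[h --> 0^'+] -->
   1 + 0 * L (semigroup 0 \1_[set eta]) eta.
  apply: cvgD; first exact: cvg_cst.
  apply: cvgM => //; apply: cvg_at_right_filter; exact: cvg_id.
rewrite mul0r addr0; apply: cvg_trans; apply: near_eq_cvg; near=> h.
have hp : 0 < h by near: h; exact: nbhs_right_gt.
by rewrite [h * _]mulrC divfK ?gt_eqF// add0r subrKC.
Unshelve. all: by end_near. Qed.

(** Write the difference as the effect of a short time h applied to the bounded
    function [semigroup (t - h) f]: it is bounded by the probability of a jump
    during h, uniformly over that function. *)
Lemma semigroup_left_continuous f t eta : bnd f -> 0 < t ->
  semigroup (t - h) f eta @[h --> 0^'+] --> semigroup t f eta.
Proof.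
move=> bf t0; have [M fM] := bf.
have c : 2 * M * (1 - semigroup h \1_[set eta] eta) @[h --> 0^'+] --> 2 * M * (1 - 1).
  by apply: cvgM; [exact: cvg_cst|apply: cvgB; [exact: cvg_cst|exact: stay_cvg1]].
rewrite subrr mulr0 in c.
apply/cvgrPdist_le => e e0.
have c' : \forall h \near 0^'+, 2 * M * (1 - semigroup h \1_[set eta] eta) <= e.
  by apply: (@cvgr_le _ _ _ _ _ _ c).
near=> h; have hp : 0 < h by near: h; exact: nbhs_right_gt.
have ht : h < t by near: h; exact: nbhs_right_lt.
have -> : semigroup t f eta = semigroup h (semigroup (t - h) f) eta.
  by rewrite -semigroupD ?subrKC//; lra.
apply: le_trans (_ : 2 * M * (1 - semigroup h \1_[set eta] eta) <= _).
  by apply: mean_away => x; exact: semigroup_norm.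
by near: h; exact: c'.
Unshelve. all: by end_near. Qed.

End Semigroup.
End Mixtures.

(** * The maximum principle *)

Section ConfigurationSpace.
Context (R : realType) (F : pointedType) (N : nat).
Local Notation E := (configuration F N).
Implicit Types (eta xi : E).

Lemma countable_configuration : countable [set: F] -> countable [set: E].
Proof.
move=> /countable_injP[e ie].
have einj : injective e by move=> x y; apply: ie; exact: in_setT.
have [x hx] := choice (@labels_exist R F N).
apply/countable_injP; exists (fun eta => choice.pickle [seq e (x eta k) | k <- enum 'I_N]).
move=> eta xi _ _ /(pcan_inj choice.pickleK) h; apply: (labels_inj (hx eta)).
have -> : x eta = x xi; last exact: hx.
apply/funext => k; apply: einj.
by have /eq_in_map := h; apply; rewrite mem_enum.
Qed.

(** All particles of such a configuration sit in a sublevel set of [V]. *)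
Lemma finite_moment_le (V : F -> R) c : (forall i, 0 <= V i) ->
  (forall a, finite_set [set i | V i <= a]) ->
  finite_set [set eta : E | moment V eta <= c].
Proof.
move=> V0 fV; have /finite_seqP[s sE] := fV c.
pose g (y : {ffun 'I_N -> seq_sub s}) : E :=
  xget point [set eta | labels (fun k => ssval (y k)) eta].
apply: (@sub_finite_set _ _ (g @` setT)); last by apply: finite_image; exact: finite_finset.
move=> eta /= We; have [x hx] := labels_exist R eta.
have xs k : x k \in s.
  suff : [set i | V i <= c] (x k) by rewrite sE.
  apply: le_trans We; rewrite (momentE _ hx) (bigD1 k)//= lerDl.
  by apply: sumr_ge0.
exists [ffun k => SeqSub (xs k)] => //.
apply: xget_unique.
  rewrite (_ : (fun k => _) = x)//.
  by apply/funext => k; rewrite ffunE.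
move=> xi hxi; apply: labels_inj hx.
by rewrite (_ : x = fun k => ssval ([ffun k => SeqSub (xs k)] k))//;
  apply/funext => k; rewrite ffunE.
Qed.

End ConfigurationSpace.

Section Contraction.
Context (R : realType) (F : pointedType) (N : nat) (Q : F -> F -> R) (p0 : F -> R).
Hypothesis rateQ : rate_matrix Q.
Hypothesis N2 : (2 <= N)%N.
Local Notation E := (configuration F N).
Context (pm pp r : R).
Hypothesis p0_bnd : forall i, pm <= p0 i <= pp.
Hypothesis pm0 : 0 <= pm.
Hypothesis r_le : forall i i', i != i' -> r + (pp - pm) <= asum (meeting_rate Q i i').
Context (V : F -> R).
Hypothesis V0 : forall i, 0 <= V i.
Hypothesis V_finite : forall c, finite_set [set i | V i <= c].
Hypothesis V_drift : forall i, abs_summable (fun j => jump_rate Q i j * V j) /\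
  asum (fun j => jump_rate Q i j * V j) <= (1 - Q i i) * V i.
Context (Pt Pt' : R -> E -> probability E R).
Hypothesis tPt : FV_transition_function Q p0 Pt.
Hypothesis tPt' : FV_transition_function Q p0 Pt'.
Implicit Types (eta xi : E) (f g : E -> R).

Local Notation W := (moment V).
Local Notation S := (semigroup Pt).
Local Notation S' := (semigroup Pt').

Let C : R := 1 + 2 * pp.

Let C0 : 0 < C.
Proof.
have /andP[a b] := p0_bnd point; have := le_trans pm0 (le_trans a b); rewrite /C; lra.
Qed.

Let W0 eta : 0 <= W eta. Proof. exact: moment_ge0. Qed.

Section Barrier.
Context (f g : E -> R) (bf : bnd f) (bg : bnd g).
Hypothesis fg : forall xi xi', f xi - g xi' <= d1 R xi xi'.
Context (ep : R) (ep0 : 0 < ep).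

Let gap t eta eta' : R := S t f eta - S' t g eta' -
  (expR (- r * t) * d1 R eta eta' + ep * expR (C * t) * (1 + W eta + W eta')).

Let gap_right_derivative t eta eta' : 0 <= t ->
  (gap (t + h) eta eta' - gap t eta eta') / h @[h --> 0^'+] -->
  FV_generator Q p0 (S t f) eta - FV_generator Q p0 (S' t g) eta' -
  ((- r * expR (- r * t)) * d1 R eta eta' +
   (C * expR (C * t)) * (ep * (1 + W eta + W eta'))).
Proof.
move=> t0.
have c1 := @semigroup_right_derivative _ _ _ _ _ tPt f t eta bf t0.
have c2 := @semigroup_right_derivative _ _ _ _ _ tPt' g t eta' bg t0.
have c3 := @expR_right_derivative R (- r) t; have c4 := @expR_right_derivative R C t.
have c5 : (expR (- r * (t + h)) - expR (- r * t)) / h * d1 R eta eta' @[h --> 0^'+] -->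
  (- r * expR (- r * t)) * d1 R eta eta' by apply: (cvgM c3); exact: cvg_cst.
have c6 : (expR (C * (t + h)) - expR (C * t)) / h * (ep * (1 + W eta + W eta')) @[h --> 0^'+] -->
  (C * expR (C * t)) * (ep * (1 + W eta + W eta')) by apply: (cvgM c4); exact: cvg_cst.
have -> : (fun h => (gap (t + h) eta eta' - gap t eta eta') / h) =
  (fun h => (S (t + h) f eta - S t f eta) / h - (S' (t + h) g eta' - S' t g eta') / h -
     ((expR (- r * (t + h)) - expR (- r * t)) / h * d1 R eta eta' +
      (expR (C * (t + h)) - expR (C * t)) / h * (ep * (1 + W eta + W eta')))).
  by apply/funext => h; rewrite /gap; ring.
exact: cvgB (cvgB c1 c2) (cvgD c5 c6).
Qed.

Let gap_left_continuous t eta eta' : 0 < t ->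
  gap (t - h) eta eta' @[h --> 0^'+] --> gap t eta eta'.
Proof.
move=> t0.
have c1 := @semigroup_left_continuous _ _ _ _ _ tPt f t eta bf t0.
have c2 := @semigroup_left_continuous _ _ _ _ _ tPt' g t eta' bg t0.
have e a : expR (a * (t - h)) @[h --> 0^'+] --> expR (a * t).
  have : expR (a * (t - h)) @[h --> (0 : R)] --> expR (a * (t - 0)).
    apply: (cvg_comp (fun h => a * (t - h)) expR); last exact: continuous_expR.
    apply: cvgM; first exact: cvg_cst.
    by apply: cvgB; [exact: cvg_cst|exact: cvg_id].
  by move/cvg_at_right_filter; rewrite subr0.
apply: cvgB; first exact: cvgB.
apply: cvgD; first by apply: cvgM => //; exact: cvg_cst.
by apply: cvgM; [apply: cvgM => //|]; exact: cvg_cst.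
Qed.

(** Outside a finite set of pairs the gap is nonpositive at all times, because W is
    large there. On the finite set, at a time when the gap is nonpositive
    everywhere, either it is negative, or it vanishes and the coupling inequality
    makes its right derivative negative; so it stays nonpositive for some more
    time. *)
Lemma barrier t : 0 <= t -> forall eta eta', gap t eta eta' <= 0.
Proof.
move: t; apply: (@real_induction R (fun t => forall eta eta', gap t eta eta' <= 0)).
  move=> t t0 before eta eta'; have [->|tn0] := eqVneq t 0.
    rewrite /gap !mulr0 expR0 mul1r mulr1 (semigroup0 tPt)// (semigroup0 tPt')//.
    rewrite subr_le0 (le_trans (fg _ _))// lerDl mulr_ge0 ?ltW//.
    by have := W0 eta; have := W0 eta'; lra.
  have tp : 0 < t by rewrite lt_neqAle eq_sym tn0.
  apply: (cvgr_to_le (@gap_left_continuous t eta eta' tp)); near=> h.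
  have hp : 0 < h by near: h; exact: nbhs_right_gt.
  have ht : h < t by near: h; exact: nbhs_right_lt.
  by apply: before; lra.
move=> t t0 now.
have [M fM] := bf; have [M' gM] := bg.
pose c := (M + M') / ep.
have far s eta eta' : 0 <= s -> c <= W eta + W eta' -> gap s eta eta' <= 0.
  move=> s0 hc; rewrite /gap.
  have h1 : S s f eta <= M by apply: le_trans (ler_norm _) _; exact: semigroup_norm.
  have h2 : - S' s g eta' <= M'.
    by apply: le_trans (ler_norm _) _; rewrite normrN; exact: semigroup_norm.
  have h3 : 0 <= expR (- r * s) * d1 R eta eta' by rewrite mulr_ge0 ?expR_ge0 ?d1_ge0.
  have h4 : 1 <= expR (C * s) by have := expR_ge1Dx (C * s); have := mulr_ge0 (ltW C0) s0; lra.
  have h5 : M + M' <= ep * (1 + W eta + W eta').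
    have -> : ep * (1 + W eta + W eta') = (W eta + W eta') * ep + ep by ring.
    by apply: ler_wpDr; [exact: ltW|rewrite -ler_pdivrMr].
  have h6 : 0 <= ep * (1 + W eta + W eta').
    by rewrite mulr_ge0 ?ltW//; have := W0 eta; have := W0 eta'; lra.
  have := ler_wpM2r h6 h4; lra.
have fin : finite_set [set eta : E | W eta <= c] by exact: finite_moment_le.
have /finite_seqP[s sE] := fin.
have near1 eta eta' : \forall h \near 0^'+, gap (t + h) eta eta' <= 0.
  apply: (@right_nonpos _ (fun h => gap (t + h) eta eta') _ _ _ _).
  - by rewrite addr0; exact: now.
  - by have := @gap_right_derivative t eta eta' t0; rewrite addr0; exact.
  - rewrite addr0 => e0.
    pose th := expR (- r * t); pose ee := ep * expR (C * t).
    have th0 : 0 <= th by exact: expR_ge0.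
    have ee0 : 0 < ee by rewrite mulr_gt0// expR_gt0.
    have := @coupling_inequality R F N Q p0 rateQ N2 pm pp r p0_bnd pm0 r_le V V0 V_drift
      (S t f) (S' t g) th ee eta eta' (semigroup_bnd Pt t bf) (semigroup_bnd Pt' t bg) th0 (ltW ee0).
    have h1 xi xi' : S t f xi - S' t g xi' <= th * d1 R xi xi' + ee * (1 + W xi + W xi').
      by have := now xi xi'; rewrite /gap -/th -/ee; lra.
    have h2 : S t f eta - S' t g eta' = th * d1 R eta eta' + ee * (1 + W eta + W eta').
      by move: e0; rewrite /gap -/th -/ee; lra.
    move=> /(_ h1 h2); have := mulr_gt0 ee0 C0; rewrite -/C -/th.
    by rewrite /ee; lra.
have all_near : \forall h \near 0^'+, forall eta eta', eta \in s -> eta' \in s ->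
    gap (t + h) eta eta' <= 0.
  have near_col eta : \forall h \near 0^'+, forall eta', eta' \in s ->
      gap (t + h) eta eta' <= 0.
    exact: (@near_all_mem _ _ _ s (fun eta' h => gap (t + h) eta eta' <= 0)).
  have near_row : \forall h \near 0^'+, forall eta, eta \in s -> forall eta', eta' \in s ->
      gap (t + h) eta eta' <= 0.
    exact: (@near_all_mem _ _ _ s
      (fun eta h => forall eta', eta' \in s -> gap (t + h) eta eta' <= 0)).
  apply: filterS near_row => h hh eta eta' es es'; exact: hh.
near=> h => eta eta'.
have hp : 0 < h by near: h; exact: nbhs_right_gt.
have [hc|hc] := leP c (W eta + W eta'); first by apply: far => //; lra.
have inS (xi : E) : W xi <= c -> xi \in s.
  by move=> hx; have : [set eta : E | W eta <= c] xi by []; rewrite sE.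
have e1 : eta \in s by apply: inS; have := W0 eta'; lra.
have e2 : eta' \in s by apply: inS; have := W0 eta; lra.
by move: eta eta' hc e1 e2; near: h; apply: filterS all_near => h hh eta eta' _; exact: hh.
Unshelve. all: by end_near. Qed.

End Barrier.

Theorem semigroup_contraction f g t eta eta' : bnd f -> bnd g ->
  (forall xi xi', f xi - g xi' <= d1 R xi xi') -> 0 <= t ->
  S t f eta - S' t g eta' <= expR (- r * t) * d1 R eta eta'.
Proof.
move=> bf bg fg t0; apply/ler_addgt0Pr => e e0.
pose X := expR (C * t) * (1 + W eta + W eta').
have X0 : 0 < X.
  by rewrite mulr_gt0 ?expR_gt0//; have := W0 eta; have := W0 eta'; lra.
have ep0 : 0 < e / X by exact: divr_gt0.
have := barrier bf bg fg ep0 t0 eta eta'.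
have -> : e / X * expR (C * t) * (1 + W eta + W eta') = e.
  by rewrite -mulrA -/X divfK// gt_eqF.
lra.
Qed.

End Contraction.

(** * Duality for the Wasserstein distance *)

Section PairProjections.
Context (R : realType) d (T : measurableType d).
Hypothesis mT : forall A : set T, measurable A.

Definition pair_fst (z : discrete_pair T) : T := z.1.
Definition pair_snd (z : discrete_pair T) : T := z.2.

HB.instance Definition _ := @isMeasurableFun.Build _ _ (discrete_pair T) T pair_fst
  (fun _ _ _ => I).
HB.instance Definition _ := @isMeasurableFun.Build _ _ (discrete_pair T) T pair_snd
  (fun _ _ _ => I).

End PairProjections.

Section RandomElements.
Context (R : realType) d (T : measurableType d).
Hypothesis mT : forall A : set T, measurable A.
Context d' (Om : measurableType d') (P : probability Om R) (Phi : Om -> T).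
Hypothesis mPhi : measurable_fun [set: Om] Phi.
Implicit Types (h : T -> R).

Lemma bnd_comp_integrable h : bnd h -> P.-integrable [set: Om] (EFin \o (h \o Phi)).
Proof.
move=> [M hM]; apply: measurable_bounded_integrable => //.
- by rewrite (le_lt_trans (probability_le1 _ _)) ?ltry.
- by apply: measurableT_comp => // _ B _; exact: mT.
- by apply: bnd_bounded; exists M => w; exact: hM.
Qed.

Lemma mf_random_element : mean_functional (fun h => \int[P]_w h (Phi w))%R.
Proof.
split.
- by move=> f g bf bg; rewrite RintegralD//; exact: bnd_comp_integrable.
- by move=> a f bf; rewrite RintegralZl//; exact: bnd_comp_integrable.
- by move=> f g bf bg fg; apply: le_Rintegral => //; exact: bnd_comp_integrable.
- by rewrite Rintegral_cst// mul1r; exact: (congr1 fine (probability_setT P)).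
Qed.

Lemma mean_law (mu : probability T R) h :
  (forall A : set T, P (Phi @^-1` A) = mu A) -> bnd h ->
  (\int[mu]_x h x = \int[P]_w h (Phi w))%R.
Proof.
move=> Pmu; apply: (mf_ext (mf_mean mT mu) mf_random_element) => A.
rewrite (mean_indic mT) -Pmu.
have -> : (fun w => \1_A (Phi w) : R) = \1_(Phi @^-1` A) by [].
rewrite /Rintegral integral_indic ?setIT//.
by rewrite -[X in measurable X]setTI; exact: mPhi.
Qed.

End RandomElements.

Section Wasserstein.
Context (R : realType) (F : pointedType) (N : nat).
Local Notation E := (configuration F N).
Hypothesis cE : countable [set: E].
Implicit Types (f g : E -> R) (mu nu : probability E R).
Local Notation mean m f := (\int[m]_x f x)%R.
Local Notation mE := (@measurable_configuration F N).

Lemma d1_bnd : bnd (fun z : E * E => d1 R z.1 z.2).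
Proof.
by exists N%:R => z; rewrite ger0_norm ?d1_ge0// d1_le_N.
Qed.

Lemma wasserstein_le_dual mu nu B :
  (forall f g, bnd f -> bnd g -> (forall x y, f x - g y <= d1 R x y) ->
    mean mu f - mean nu g <= B) ->
  (wasserstein mu nu <= B%:E)%E.
Proof.
move=> h; have [pi [pi1 pi2 piB]] := kantorovich mE cE d1_bnd h.
apply: (@le_trans _ _ ('E_pi [fun z => d1 R (pair_fst z) (pair_snd z)])%E).
  apply: ereal_inf_lbound; exists _, (discrete_pair E), pi, (@pair_fst _ E), (@pair_snd _ E).
  by split.
rewrite unlock -[leLHS]fineK; first by rewrite lee_fin.
have mD (A : set (discrete_pair E)) : measurable A by [].
exact: (integrable_fin_num _ (bnd_integrable mD pi d1_bnd)).
Qed.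

Section Coupled.
Context d (Om : measurableType d) (P : probability Om R) (X X' : {RV P >-> E}).

Let XX (w : Om) : discrete_pair E := (X w, X' w).

Lemma measurable_coupling : measurable_fun [set: Om] XX.
Proof.
move=> _ A _; rewrite setTI.
have -> : XX @^-1` A = \bigcup_x \bigcup_y
    (X @^-1` [set x] `&` X' @^-1` [set y] `&` [set _ | A (x, y)]).
  apply/seteqP; split=> [w /= Aw|w [x _ [y _ [[/= e1 e2] Axy]]]].
    by exists (X w) => //; exists (X' w).
  by rewrite /XX e1 e2.
apply: countable_bigcupT_measurable => // x; apply: countable_bigcupT_measurable => // y.
apply: measurableI; last first.
  have [Axy|nA] := pselect (A (x, y)).
    by rewrite (_ : [set _ | _] = setT)//; apply/seteqP; split.
  by rewrite (_ : [set _ | _] = set0)//; apply/seteqP; split.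
by apply: measurableI; rewrite -[X in measurable X]setTI; exact: measurable_funPT.
Qed.

Lemma coupling_mean_le mu nu f g k :
  (forall A : set E, distribution P X A = mu A) ->
  (forall A : set E, distribution P X' A = nu A) ->
  bnd f -> bnd g -> (forall x y, f x - g y <= k * d1 R x y) ->
  ((mean mu f - mean nu g)%:E <= k%:E * 'E_P [fun w => d1 R (X w) (X' w)])%E.
Proof.
move=> Xmu X'nu bf bg fg.
have bfst (h : E -> R) : bnd h -> bnd (fun z : E * E => h z.1) by move=> [M hM]; exists M => z.
have bsnd (h : E -> R) : bnd h -> bnd (fun z : E * E => h z.2) by move=> [M hM]; exists M => z.
have mD (A : set (discrete_pair E)) : measurable A by [].
have hm := mf_random_element mD P measurable_coupling.
have mX : measurable_fun [set: Om] X by exact: measurable_funPT.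
have mX' : measurable_fun [set: Om] X' by exact: measurable_funPT.
rewrite (mean_law mE mX Xmu bf) (mean_law mE mX' X'nu bg).
rewrite unlock -[X in (_ <= _ * X)%E]fineK; last first.
  exact: (integrable_fin_num _ (bnd_comp_integrable mD P measurable_coupling d1_bnd)).
rewrite -EFinM lee_fin.
rewrite -[X in X <= _](mfB hm (bfst _ bf) (bsnd _ bg)).
rewrite -[X in _ <= X](mfZ hm k d1_bnd).
apply: (mf_le hm (bndB (bfst _ bf) (bsnd _ bg)) (bndZ k d1_bnd)) => -[x y].
exact: fg.
Qed.

End Coupled.

Lemma wasserstein_ge0 mu nu : (0 <= wasserstein mu nu)%E.
Proof.
apply: le_ereal_inf_tmp => _ [d [Om [P [X [X' [_ _ ->]]]]]].
by rewrite unlock; apply: integral_ge0 => w _; rewrite lee_fin d1_ge0.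
Qed.

(** The form in which duality is used: pairs (f, g) for the final laws are converted
    into pairs (f0, g0) for the initial laws. *)
Lemma wasserstein_le mu nu mu0 nu0 k : 0 < k ->
  (forall f g, bnd f -> bnd g -> (forall x y, f x - g y <= d1 R x y) ->
    exists f0 g0, [/\ bnd f0, bnd g0, (forall x y, f0 x - g0 y <= k * d1 R x y) &
      mean mu f - mean nu g = mean mu0 f0 - mean nu0 g0]) ->
  (wasserstein mu nu <= k%:E * wasserstein mu0 nu0)%E.
Proof.
move=> k0 h; rewrite -lee_pdivrMl//; apply: le_ereal_inf_tmp.
move=> _ [d [Om [P [X [X' [h1 h2 ->]]]]]]; rewrite lee_pdivrMl//.
have [J JE] : exists J : R, ('E_P [fun w => d1 R (X w) (X' w)])%E = J%:E.
  exists (\int[P]_w d1 R (X w) (X' w))%R; rewrite unlock /Rintegral fineK//.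
  have mD (A : set (discrete_pair E)) : measurable A by [].
  exact: (integrable_fin_num _ (bnd_comp_integrable mD P (measurable_coupling X X') d1_bnd)).
rewrite JE -EFinM; apply: wasserstein_le_dual => f g bf bg fg.
have [f0 [g0 [bf0 bg0 fg0 ->]]] := h f g bf bg fg.
by have := coupling_mean_le h1 h2 bf0 bg0 fg0; rewrite JE -EFinM lee_fin.
Qed.

End Wasserstein.

(** * The invariant distribution *)

Section Invariant.
Context (R : realType) (F : pointedType) (N : nat).
Local Notation E := (configuration F N).
Hypothesis cE : countable [set: E].
Context (L : (E -> R) -> E -> R) (Pt : R -> E -> probability E R).
Hypothesis tPt : transition_function L Pt.
Local Notation S := (semigroup Pt).
Context (r : R) (r0 : 0 < r).
Hypothesis contraction : forall f g t eta eta', bnd f -> bnd g ->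
  (forall xi xi', f xi - g xi' <= d1 R xi xi') -> 0 <= t ->
  S t f eta - S t g eta' <= expR (- r * t) * d1 R eta eta'.
Implicit Types (f : E -> R) (eta : E).
Local Notation mean m f := (\int[m]_x f x)%R.
Local Notation mE := (@measurable_configuration F N).

(** Distinct configurations are at distance at least 1, so a function with values in
    an interval of length 1 satisfies [f x - f y <= d1 x y]. *)
Lemma oscillation f M t eta eta' : 0 < M -> (forall x, `|f x| <= M) -> 0 <= t ->
  `|S t f eta - S t f eta'| <= 2 * M * N%:R * expR (- r * t).
Proof.
move=> M0 fM t0; have bf : bnd f by exists M.
have M2 : 0 < 2 * M by lra.
suff h xi xi' : S t f xi - S t f xi' <= 2 * M * N%:R * expR (- r * t).
  by rewrite ler_norml lerNl opprB !h.
pose g x := (2 * M)^-1 * f x.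
have bg : bnd g by exact: bndZ.
have fE : f = fun x => 2 * M * g x.
  by apply/funext => x; rewrite /g mulrA mulfV ?mul1r// gt_eqF.
have SE y : S t f y = 2 * M * S t g y.
  by rewrite [in LHS]fE /semigroup (mfZ (mf_mean mE (Pt t y))).
have gg x y : g x - g y <= d1 R x y.
  have [->|ne] := eqVneq x y; first by rewrite subrr d1_ge0.
  apply: le_trans (d1_ge1 R ne); rewrite -mulrBr ler_pdivrMl// mulr1.
  have := fM x; have := fM y; rewrite !ler_norml => /andP[a b] /andP[c d]; lra.
have := contraction xi xi' bg bg gg t0.
rewrite !SE -mulrBr -mulrA ler_pM2l// => /le_trans; apply.
by rewrite mulrC ler_wpM2r ?expR_ge0// d1_le_N.
Qed.

(** After time s - t the process is somewhere, and from everywhere it has the same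
    mean at time t up to the oscillation. *)
Lemma semigroup_cauchy f M s t eta eta' : 0 < M -> (forall x, `|f x| <= M) -> 0 <= t -> t <= s ->
  `|S s f eta - S t f eta'| <= 2 * M * N%:R * expR (- r * t).
Proof.
move=> M0 fM t0 ts; have bf : bnd f by exists M.
have -> : S s f eta = S (s - t) (S t f) eta.
  by rewrite -(semigroupD tPt)// ?subrK// subr_ge0.
have hm := mf_mean mE (Pt (s - t) eta).
have bS := semigroup_bnd Pt t bf.
have -> : S (s - t) (S t f) eta - S t f eta' = mean (Pt (s - t) eta) (fun x => S t f x - S t f eta').
  by rewrite (mfB hm)// ?(mf_cst _ hm)//; exact: bnd_cst.
by apply: mean_norm => x; exact: oscillation.
Qed.

Lemma decay_small K e : 0 < e -> exists n : nat, K * expR (- r * n%:R) <= e.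
Proof.
move=> e0; exists (Num.truncn (K / (e * r))).+1; set n := (_.+1).
have nK : K / (e * r) < n%:R by exact: truncnS_gt.
rewrite mulNr expRN ler_pdivrMr ?expR_gt0//.
have := expR_ge1Dx (r * n%:R).
move: nK; rewrite ltr_pdivrMr ?mulr_gt0// => nK h.
have := ler_wpM2l (ltW e0) h; lra.
Qed.

Let x0 : E := point.
Let limf f := limn (fun n => S n%:R f x0).

Let semigroup_cvg f : bnd f -> S n%:R f x0 @[n --> \oo] --> limf f.
Proof.
move=> bf; have [M M0 fM] := bnd_ge0 bf.
apply/cauchy_cvgP/cauchy_exP => e e0; have e2 : 0 < e / 2 by lra.
have [n hn] := decay_small (2 * M * N%:R) e2.
exists (S n%:R f x0); exists n => // m /= nm; rewrite /ball /= distrC.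
apply: le_lt_trans (semigroup_cauchy x0 x0 M0 fM (ler0n _ n) (_ : n%:R <= m%:R)) _.
  by rewrite ler_nat.
by apply: le_lt_trans hn _; lra.
Qed.

Let limf_rate f M t eta : 0 < M -> (forall x, `|f x| <= M) -> 0 <= t ->
  `|limf f - S t f eta| <= 2 * M * N%:R * expR (- r * t).
Proof.
move=> M0 fM t0; have bf : bnd f by exists M.
have c : `|S n%:R f x0 - S t f eta| @[n --> \oo] --> `|limf f - S t f eta|.
  by apply: cvg_norm; apply: cvgB; [exact: semigroup_cvg|exact: cvg_cst].
apply: (cvgr_to_le c); exists (Num.truncn t).+1 => // n /= tn.
apply: semigroup_cauchy => //; apply: ltW; apply: lt_le_trans (truncnS_gt t) _.
by rewrite ler_nat.
Qed.

Let mf_limf : mean_functional limf.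
Proof.
have hn n := mf_mean mE (Pt n%:R x0).
split.
- move=> f g bf bg; apply/cvg_lim => //.
  have -> : (fun n => S n%:R (fun x => f x + g x) x0) =
      (fun n => S n%:R f x0 + S n%:R g x0).
    by apply/funext => n; rewrite /semigroup (mfD (hn n)).
  by apply: cvgD; exact: semigroup_cvg.
- move=> a f bf; apply/cvg_lim => //.
  have -> : (fun n => S n%:R (fun x => a * f x) x0) = (fun n => a * S n%:R f x0).
    by apply/funext => n; rewrite /semigroup (mfZ (hn n)).
  by apply: cvgM; [exact: cvg_cst|exact: semigroup_cvg].
- move=> f g bf bg fg; apply: (ler_cvg_to (semigroup_cvg bf) (semigroup_cvg bg)).
  by apply: nearW => n; apply: (mf_le (hn n)).
- apply/cvg_lim => //; have -> : (fun n => S n%:R (fun=> 1) x0) = fun=> 1.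
    by apply/funext => n; rewrite /semigroup (mf_cst 1 (hn n)).
  exact: cvg_cst.
Qed.

(** The limit of [S t f] is uniform over |f| <= 1. Tightness of the limit and its
    invariance are inherited from a fixed large time. *)
Lemma invariant_exists : exists nu : probability E R,
  invariant_distribution Pt nu /\
  forall nu' : probability E R, invariant_distribution Pt nu' ->
    forall A : set E, nu' A = nu A.
Proof.
have ind1 (A : set E) x : `|\1_A x : R| <= 1.
  by rewrite indicE ger0_norm// lern1 leq_b1.
have tight e : 0 < e -> exists K : set E, finite_set K /\ limf \1_(~` K) <= e.
  move=> e0; have e2 : 0 < e / 2 by lra.
  have [n hn] := decay_small (2 * 1 * N%:R) e2.
  have [K [fK hK]] := countable_tight mE cE (Pt n%:R x0) e2.
  exists K; split=> //.
  have := limf_rate x0 ltr01 (ind1 (~` K)) (ler0n _ n).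
  rewrite ler_norml => /andP[_]; rewrite -/(semigroup Pt n%:R \1_(~` K) x0) in hK; lra.
have [nu hnu] := mf_probability mE mf_limf tight.
have fineA (mu : probability E R) (A : set E) : mu A = (mean mu \1_A)%:E.
  by rewrite (mean_indic mE) fineK// fin_num_measure.
have invE (mu : probability E R) t (A : set E) :
    (\int[mu]_eta Pt t eta A)%E = (mean mu (S t \1_A))%:E.
  have bS := semigroup_bnd Pt t (bnd_indic R A).
  rewrite /Rintegral fineK; last exact: (integrable_fin_num _ (bnd_integrable mE mu bS)).
  apply: eq_integral => eta _; rewrite fineA //.
exists nu; split.
  move=> t A t0; rewrite invE fineA; congr EFin.
  rewrite -!hnu; [|exact: bnd_indic|exact/semigroup_bnd/bnd_indic].
  have S1 x : `|S t \1_A x| <= 1 by apply: semigroup_norm => y; exact: ind1.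
  apply/eqP; rewrite -subr_eq0 -normr_le0; apply/ler_addgt0Pr => e e0; rewrite add0r.
  have e2 : 0 < e / 2 by lra.
  have [n hn] := decay_small (2 * 1 * N%:R) e2.
  have h1 := limf_rate x0 ltr01 S1 (ler0n _ n).
  have h2 := limf_rate x0 ltr01 (ind1 A) (addr_ge0 (ler0n _ n) t0).
  rewrite (semigroupD tPt) ?ler0n// in h2; last exact: bnd_indic.
  have h3 : expR (- r * (n%:R + t)) <= expR (- r * n%:R).
    by rewrite ler_expR !mulNr lerN2 ler_pM2l// lerDl.
  have N0 : 0 <= N%:R :> R by [].
  have h4 := ler_wpM2l (mulr_ge0 (mulr_ge0 (ler0n R 2) ler01) N0) h3.
  have -> : limf (S t \1_A) - limf \1_A =
    (limf (S t \1_A) - S n%:R (S t \1_A) x0) - (limf \1_A - S n%:R (S t \1_A) x0) by lra.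
  apply: le_trans (ler_normB _ _) _.
  by have := lerD h1 h2; lra.
move=> nu' inv A; rewrite !fineA; congr EFin; rewrite -hnu; last exact: bnd_indic.
apply/eqP; rewrite -subr_eq0 -normr_le0; apply/ler_addgt0Pr => e e0; rewrite add0r.
have [n hn] := decay_small (2 * 1 * N%:R) e0.
have -> : mean nu' \1_A = mean nu' (S n%:R \1_A).
  by apply: EFin_inj; rewrite -fineA -invE inv.
have hm := mf_mean mE nu'.
have -> : mean nu' (S n%:R \1_A) - limf \1_A = mean nu' (fun x => S n%:R \1_A x - limf \1_A).
  rewrite (mfB hm) ?(mf_cst _ hm)//; last exact: bnd_cst.
  exact/semigroup_bnd/bnd_indic.
apply: mean_norm => x; apply: le_trans hn; rewrite distrC.
exact: limf_rate ltr01 (ind1 A) _.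
Qed.

End Invariant.

(** * The Fleming-Viot process *)

Section Rho.
Context (R : realType) (F : pointedType) (Q : F -> F -> R).
Hypothesis rateQ : rate_matrix Q.
Implicit Types (i j : F).

(** The two single jumps of the definition of lambda become the values of the
    meeting rate at the sites [i] and [i']. *)
Lemma lambda_le i i' : i != i' -> (lambda Q <= (asum (meeting_rate Q i i'))%:E)%E.
Proof.
move=> ii'; apply: ereal_inf_lbound; exists i, i'; split=> //.
have i'i : i' != i by rewrite eq_sym.
pose w j := if (j != i) && (j != i') then Num.min (Q i j) (Q i' j) else 0.
have w0 j : 0 <= w j.
  rewrite /w; case: ifP => // /andP[ji ji'].
  by rewrite le_min !rateQ.1 ?[i == j]eq_sym ?[i' == j]eq_sym.
have [s1 a1] := delta_summ i (Q i' i); have [s2 a2] := delta_summ i' (Q i i').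
have mE : meeting_rate Q i i' = fun j => Q i' i * (j == i)%:R + Q i i' * (j == i')%:R + w j.
  apply/funext => j; rewrite /meeting_rate /w /jump_rate.
  have [->|ji] := eqVneq j i; first by rewrite (negPf ii') /=; lra.
  by have [->|ji'] := eqVneq j i' => /=; rewrite ?(negPf i'i); lra.
have sw : abs_summable w.
  apply: le_summ (summ_meeting_rate rateQ i i') => j.
  rewrite ger0_norm// mE lerDr addr_ge0// mulr_ge0//; exact: rateQ.1.
rewrite mE asumD//; last exact: summD.
rewrite asumD// a1 a2 EFinD [Q i' i + _]addrC asum_nonneg//; congr (_ + _)%E.
rewrite [RHS]esum_mkcond; apply: eq_esum => j _; rewrite /w.
case: ifP => [/andP[ji ji']|h]; first by rewrite mem_set.
by rewrite memNset//= => -[ji ji']; rewrite ji ji' in h.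
Qed.

Lemma lambda_ge0 : (0 <= lambda Q)%E.
Proof.
apply: le_ereal_inf_tmp => _ [i [i' [ii' ->]]]; apply: adde_ge0.
  by rewrite lee_fin addr_ge0//; apply: rateQ.1 => //; rewrite eq_sym.
apply: esum_ge0 => j [ji ji']; rewrite lee_fin le_min.
by rewrite !rateQ.1 ?[i == j]eq_sym ?[i' == j]eq_sym.
Qed.

(** The infimum that defines lambda is over the empty set exactly when there is
    only one site. *)
Lemma rho_cases (p0 : F -> R) :
  (exists r, rho Q p0 = r%:E /\ forall i i', i != i' ->
     r + (sup (range p0) - inf (range p0)) <= asum (meeting_rate Q i i')) \/
  ((forall i i', i = i') /\ rho Q p0 = +oo%E).
Proof.
have [[i [i' ii']]|nex] := pselect (exists i i', i != i').
  left; have lfin : lambda Q \is a fin_num.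
    by rewrite ge0_fin_numE ?lambda_ge0// (le_lt_trans (lambda_le ii')) ?ltry.
  exists (fine (lambda Q) - (sup (range p0) - inf (range p0))); split.
    by rewrite EFinB fineK.
  by move=> j j' jj'; rewrite subrK -lee_fin fineK//; exact: lambda_le.
have all_eq i i' : i = i'.
  by apply/eqP; apply: contrapT => /negP ii'; apply: nex; exists i, i'.
right; split=> //; rewrite /rho /lambda (_ : [set l | _] = set0) ?ereal_inf0//.
by rewrite -subset0 => l [i [i' [+ _]]]; rewrite (all_eq i i') eqxx.
Qed.

End Rho.

Section FlemingViotContraction.
Context (R : realType) (F : pointedType) (N : nat).
Local Notation E := (configuration F N).
Hypothesis countF : countable [set: F].
Implicit Types (mu nu : probability E R).

Lemma wasserstein_singleton mu nu : (forall i i' : F, i = i') -> (wasserstein mu nu <= 0)%E.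
Proof.
move=> all_eq; apply: (wasserstein_le_dual (countable_configuration R N countF)).
move=> f g bf bg fg.
have E1 (xi : E) : xi = point.
  have [x hx] := labels_exist R xi; have [y hy] := labels_exist R (point : E).
  by apply: (labels_inj hx); rewrite (_ : x = y)//; apply/funext => k; exact: all_eq.
have d0 : d1 R (point : E) (point : E) = 0.
  have [x hx] := labels_exist R (point : E).
  apply/le_anti; rewrite d1_ge0 andbT (le_trans (d1_labels R hx hx))// big1// => k _.
  by rewrite eqxx.
have c (h : E -> R) : h = fun=> h point by apply/funext => x; rewrite (E1 x).
have mE := @measurable_configuration F N.
rewrite (c f) (c g) (mf_cst _ (mf_mean mE mu)) (mf_cst _ (mf_mean mE nu)).
by rewrite -d0; exact: fg.
Qed.

(** The Markov property between the times 0 and t, for the sure event. *)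
Lemma process_marginal (Pt : R -> E -> probability E R) d (Om : measurableType d)
    (P : probability Om R) (eta : R -> {RV P >-> E}) t (A : set E) :
  markov_process Pt eta -> 0 <= t ->
  distribution P (eta t) A = (\int[distribution P (eta 0%R)]_x Pt t x A)%E.
Proof.
move=> hm t0; rewrite ge0_integral_distribution//.
have := hm (0 : R) t setT A (lexx (0 : R)) t0; rewrite add0r setTI; apply.
by apply: sub_sigma_algebra; exists (0 : R), setT; rewrite lexx preimage_setT.
Qed.

Context (Q : F -> F -> R) (p0 : F -> R).
Hypothesis rateQ : rate_matrix Q.
Hypothesis precQ : positive_recurrent Q.
Hypothesis p0_ge0 : forall i, 0 <= p0 i.
Hypothesis p0_ub : has_ubound (range p0).
Hypothesis N2 : (2 <= N)%N.
Context (r : R).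
Hypothesis r_le : forall i i', i != i' ->
  r + (sup (range p0) - inf (range p0)) <= asum (meeting_rate Q i i').

Lemma FV_contraction (Pt Pt' : R -> E -> probability E R) (f g : E -> R) t eta eta' :
  FV_transition_function Q p0 Pt -> FV_transition_function Q p0 Pt' ->
  bnd f -> bnd g -> (forall xi xi', f xi - g xi' <= d1 R xi xi') -> 0 <= t ->
  semigroup Pt t f eta - semigroup Pt' t g eta' <= expR (- r * t) * d1 R eta eta'.
Proof.
move=> tPt tPt' bf bg fg t0.
have /countable_injP[e ie] := countF.
have einj : injective e by move=> x y; apply: ie; exact: in_setT.
have [V [V0 Vfin Vdrift]] := lyapunov_exists rateQ precQ einj.
have lb : has_lbound (range p0) by exists 0 => _ [i _ <-].
have bnds i : inf (range p0) <= p0 i <= sup (range p0).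
  by rewrite ge_inf//= ?ub_le_sup//; exists i.
have inf0 : 0 <= inf (range p0).
  by apply: lb_le_inf; [exists (p0 point), point|move=> _ [i _ <-]].
exact: (semigroup_contraction rateQ N2 bnds inf0 r_le V0 Vfin Vdrift tPt tPt').
Qed.

Lemma FV_wasserstein_contraction (Pt Pt' : R -> E -> probability E R) t mu0 nu0 mu nu :
  FV_transition_function Q p0 Pt -> FV_transition_function Q p0 Pt' -> 0 <= t ->
  (forall A : set E, mu A = (\int[mu0]_x Pt t x A)%E) ->
  (forall A : set E, nu A = (\int[nu0]_x Pt' t x A)%E) ->
  (wasserstein mu nu <= (expR (- r * t))%:E * wasserstein mu0 nu0)%E.
Proof.
move=> tPt tPt' t0 hmu hnu.
apply: (wasserstein_le (countable_configuration R N countF)); first exact: expR_gt0.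
move=> f g bf bg fg; exists (semigroup Pt t f), (semigroup Pt' t g); split.
- exact: semigroup_bnd.
- exact: semigroup_bnd.
- by move=> x y; exact: FV_contraction.
- by rewrite (mixture_mean hmu bf) (mixture_mean hnu bg).
Qed.

End FlemingViotContraction.

Unset Implicit Arguments.

Theorem theorem1p1 (R : realType) (F : pointedType)
    (countF : countable [set: F])
    (Q : F -> F -> R) (p0 : F -> R) (N : nat)
    (rateQ : rate_matrix Q) (irrQ : irreducible Q)
    (precQ : positive_recurrent Q)
    (p0_ge0 : forall i, 0 <= p0 i) (p0_neq0 : exists i, p0 i != 0)
    (p0_bnd : has_ubound (range p0)) (N_ge2 : (2 <= N)%N) :
  (forall (d d' : measure_display)
      (Om : measurableType d) (Om' : measurableType d')
      (P : probability Om R) (P' : probability Om' R)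
      (eta : R -> {RV P >-> configuration F N})
      (eta' : R -> {RV P' >-> configuration F N}),
    FV_process Q p0 eta -> FV_process Q p0 eta' ->
    forall t : R, 0 <= t ->
      (wasserstein (distribution P (eta t)) (distribution P' (eta' t))
       <= expeR (- rho Q p0 * t%:E)
          * wasserstein (distribution P (eta 0%R)) (distribution P' (eta' 0%R)))%E)
  /\
  (forall Pt : R -> configuration F N -> probability (configuration F N) R,
    FV_transition_function Q p0 Pt -> (0 < rho Q p0)%E ->
    exists nuN : probability (configuration F N) R,
      [/\ invariant_distribution Pt nuN,
          forall nu : probability (configuration F N) R,
            invariant_distribution Pt nu ->
            forall A : set (configuration F N), nu A = nuN A
        & forall (d : measure_display) (Om : measurableType d)
            (P : probability Om R) (eta : R -> {RV P >-> configuration F N}),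
            FV_process Q p0 eta ->
            forall t : R, 0 <= t ->
              (wasserstein (distribution P (eta t)) nuN
               <= expeR (- rho Q p0 * t%:E)
                  * wasserstein (distribution P (eta 0%R)) nuN)%E]).
Proof.
have contraction Pt Pt' t (mu0 nu0 mu nu : probability (configuration F N) R) :
    FV_transition_function Q p0 Pt -> FV_transition_function Q p0 Pt' -> 0 <= t ->
    (forall A : set (configuration F N), mu A = (\int[mu0]_x Pt t x A)%E) ->
    (forall A : set (configuration F N), nu A = (\int[nu0]_x Pt' t x A)%E) ->
    (wasserstein mu nu <= expeR (- rho Q p0 * t%:E) * wasserstein mu0 nu0)%E.
  move=> tPt tPt' t0 hmu hnu.
  have [[r [-> r_le]]|[all_eq _]] := rho_cases rateQ p0.
    rewrite -EFinN -EFinM.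
    exact: (FV_wasserstein_contraction countF rateQ precQ p0_ge0 p0_bnd N_ge2 r_le tPt tPt').
  apply: (le_trans (wasserstein_singleton countF _ _ all_eq)).
  by apply: mule_ge0; [exact: expeR_ge0|exact: wasserstein_ge0].
split=> [d d' Om Om' P P' eta eta' [Pt [tPt mPt]] [Pt' [tPt' mPt']] t t0|Pt tPt rho0].
  by apply: (contraction Pt Pt') => // A; exact: process_marginal.
have [r r0 r_le] : exists2 r, 0 < r & forall i i', i != i' ->
    r + (sup (range p0) - inf (range p0)) <= asum (meeting_rate Q i i').
  have [[r [rE r_le]]|[all_eq _]] := rho_cases rateQ p0.
    by exists r => //; move: rho0; rewrite rE lte_fin.
  by exists 1 => // i i'; rewrite (all_eq i i') eqxx.
have [nu [nu_inv nu_uniq]] := invariant_exists (countable_configuration R N countF) tPt r0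
  (fun f g t eta eta' => @FV_contraction _ _ _ countF _ _ rateQ precQ p0_ge0 p0_bnd N_ge2 _ r_le
    _ _ f g t eta eta' tPt tPt).
exists nu; split=> // d Om P eta [Pt' [tPt' mPt']] t t0.
by apply: (contraction Pt' Pt) => // A; [exact: process_marginal|rewrite nu_inv].
Qed.
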